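(* Let $p$ be an MSOL-polynomial in indeterminates $X_1,\dots,X_t$ and let $(G_n)_{n\in\mathbb{N}}$ be a bi-iteratively constructible graph family. Suppose that either $p$ is an MSOL$_G$-polynomial, or $(G_n)$ is a bounded bi-iteratively constructible family. Then the sequence $(p(G_n;X_1,\dots,X_t))_{n\in\mathbb{N}}$ is C$^2$-finite over the field $\mathbb{C}(X_1,\dots,X_t)$.
   Context: A $k$-graph is $G=(V,E;R_1,\dots,R_k)$ where $(V,E)$ is a finite simple graph (its underlying graph) and $R_1,\dots,R_k\subseteq V$ (the labels, possibly empty) partition $V$. Basic operations on $k$-graphs: $Add_i$ adds a new isolated vertex to $R_i$; $\rho_{i\to j}$ moves all vertices of $R_i$ into $R_j$, leaving $R_i$ empty; $\eta_{i,j}$ adds all possible edges between vertices of $R_i$ and vertices of $R_j$; for $b\in\mathbb{N}$, $\eta^b_{i,j}$ acts as $\eta_{i,j}$ if $|R_i\cup R_j|\le b$ and otherwise leaves the graph unchanged; $\delta_{i,j}$ removes all edges between $R_i$ and $R_j$. An elementary operation is a finite composition of basic operations ($id$ is the empty composition); it is bounded if it uses no operation of type $\eta_{i,j}$ (operations $\eta^b_{i,j}$ are allowed). A sequence of $k$-graphs is an $F$-iteration family (iteratively constructible) if $G_{n+1}=F(G_n)$ for all $n$, for a $k$-graph $G_0$ and an elementary operation $F$. It is an $(H,F,L)$-bi-iteration family (bi-iteratively constructible) if $G_{n+1}=H(F^n(L(G_n)))$ for all $n$, where $G_0$ is a $k$-graph, $H,F,L$ are elementary operations and $F^n$ is $n$-fold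 application of $F$. A sequence of graphs is (bi-)iteratively constructible if, for some $k$, it is the sequence of underlying graphs of a (bi-)iteratively constructible sequence of $k$-graphs; it is bounded if this can be done with $H,F,L$ bounded. Graphs are ordered: each carries a linear order $\le$ on its vertices (for graphs built by basic operations, new vertices are larger than existing ones). MSOL formulas use vertex variables $x_i$, vertex-set variables $U_i$ and edge-set variables $B_i$ (ranging over subsets of $E$), atomic formulas $x_i=x_j$, $(x_i,x_j)\in E$, $x_i\le x_j$, $x_i\in U_j$, $(x_i,x_j)\in B_\ell$, closed under $\lor,\land,\neg,\to$ and quantification $\forall,\exists$ over all three kinds of variables. An MSOL-polynomial is a graph invariant of the form $p(G)=\sum_{(U_1,\dots,U_\ell,B_1,\dots,B_m):\,G\models\Phi(\bar U,\bar B)} X_1^{|U_1|}\cdots X_{\ell'}^{|U_{\ell'}|}X_{\ell'+1}^{|B_1|}\cdots X_{\ell'+m'}^{|B_{m'}|}$, where $\Phi$ is an MSOL formula, $\ell'\le\ell$, $m'\le m$, the $U_i$ range over vertex subsets and the $B_j$ over edge subsets. It is an MSOL$_G$-polynomial if $m=0$ and $\Phi$ contains no edge-set variables. C-finite and C$^2$-finite sequences over a field $\mathbb{K}$: $(a_n)$ is C-finite if there exist $s$ and constants $c^{(0)},\dots,c^{(s-1)}\in\mathbb{K}$ with $a_{n+s}=\sum_{i<s}c^{(i)}a_{n+i}$ for every $n\ge s$; it is C$^2$-finite if there exist $s$ and C-finite sequences $c^{(0)}_n,\dots,c^{(s)}_n$ over $\mathbb{K}$ with $c^{(s)}_n\ne0$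 for all $n$ and $c^{(s)}_na_{n+s}=\sum_{i<s}c^{(i)}_na_{n+i}$ for every $n\ge s$. *)

(* Defs.v *)
From HB Require Import structures.
From mathcomp Require Import all_boot all_order all_algebra.
Set Implicit Arguments. Unset Strict Implicit. Unset Printing Implicit Defensive.
Import Order.TTheory GRing.Theory Num.Theory.

(* k-graphs.  Vertices are 0, ..., nv-1; their linear order is the order
   of nat (so vertices created later are larger).  The underlying simple
   graph has an edge between distinct x,y < nv iff adj x y || adj y x.
   Labels: lab x : 'I_k, so R_1..R_k automatically partition V. *)
Record kgraph (k : nat) := KGraph {
  nv  : nat;
  adj : nat -> nat -> bool;
  lab : nat -> 'I_k }.

Definition gedge k (G : kgraph k) (x y : nat) : bool :=
  [&& x < nv G, y < nv G, x != y & adj G x y || adj G y x].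

Inductive basic_op (k : nat) :=
  | OAdd of 'I_k
  | ORen of 'I_k & 'I_k
  | OEta of 'I_k & 'I_k
  | OEtaB of nat & 'I_k & 'I_k
  | ODel of 'I_k & 'I_k.

Definition between k (G : kgraph k) (i j : 'I_k) (x y : nat) : bool :=
  ((lab G x == i) && (lab G y == j)) || ((lab G x == j) && (lab G y == i)).

Definition add_edges k (G : kgraph k) (i j : 'I_k) : kgraph k :=
  KGraph (nv G) (fun x y => adj G x y || ((x != y) && between G i j x y)) (lab G).

Definition apply_basic k (o : basic_op k) (G : kgraph k) : kgraph k :=
  match o with
  | OAdd i => KGraph (nv G).+1
                (fun x y => [&& adj G x y, x < nv G & y < nv G])
                (fun x => if x == nv G then i else lab G x)
  | ORen i j => KGraph (nv G) (adj G)
                (fun x => if lab G x == i then j else lab G x)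
  | OEta i j => add_edges G i j
  | OEtaB b i j =>
      if count (fun x => (lab G x == i) || (lab G x == j)) (iota 0 (nv G)) <= b
      then add_edges G i j else G
  | ODel i j => KGraph (nv G) (fun x y => adj G x y && ~~ between G i j x y) (lab G)
  end.

Definition elem_op k := seq (basic_op k).

Definition apply_elem k (F : elem_op k) (G : kgraph k) : kgraph k :=
  foldl (fun H o => apply_basic o H) G F.

Definition is_eta k (o : basic_op k) : bool :=
  if o is OEta _ _ then true else false.

Definition bounded_op k (F : elem_op k) : bool := ~~ has (@is_eta k) F.

Fixpoint bi_iter k (G0 : kgraph k) (H F L : elem_op k) (n : nat) : kgraph k :=
  if n is n'.+1 then
    apply_elem H (iter n' (apply_elem F) (apply_elem L (bi_iter G0 H F L n')))
  else G0.

Inductive msol :=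
  | FEq of nat & nat
  | FEdge of nat & nat
  | FLe of nat & nat
  | FInU of nat & nat
  | FInB of nat & nat & nat
  | FOr of msol & msol
  | FAnd of msol & msol
  | FNot of msol
  | FImp of msol & msol
  | FAllV of nat & msol | FExV of nat & msol
  | FAllU of nat & msol | FExU of nat & msol
  | FAllB of nat & msol | FExB of nat & msol.

Fixpoint no_edgeset (phi : msol) : bool :=
  match phi with
  | FInB _ _ _ | FAllB _ _ | FExB _ _ => false
  | FOr a b | FAnd a b | FImp a b => no_edgeset a && no_edgeset b
  | FNot a => no_edgeset a
  | FAllV _ a | FExV _ a | FAllU _ a | FExU _ a => no_edgeset a
  | _ => true
  end.

Definition upd T (e : nat -> T) (i : nat) (v : T) : nat -> T :=
  fun j => if j == i then v else e j.

(* Edge sets are represented as sets of ordered pairs (u,v) with u < v. *)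
Definition edge_set k (G : kgraph k) : {set 'I_(nv G) * 'I_(nv G)} :=
  [set p : 'I_(nv G) * 'I_(nv G) | (val p.1 < val p.2) && gedge G (val p.1) (val p.2)].

Fixpoint sat k (G : kgraph k) (ev : nat -> nat) (eU : nat -> {set 'I_(nv G)})
    (eB : nat -> {set 'I_(nv G) * 'I_(nv G)}) (phi : msol) : bool :=
  match phi with
  | FEq i j => ev i == ev j
  | FEdge i j => gedge G (ev i) (ev j)
  | FLe i j => ev i <= ev j
  | FInU i j => [exists v : 'I_(nv G), (val v == ev i) && (v \in eU j)]
  | FInB i j l => [exists p in eB l,
        ((val p.1 == ev i) && (val p.2 == ev j)) ||
        ((val p.1 == ev j) && (val p.2 == ev i))]
  | FOr a b => @sat k G ev eU eB a || @sat k G ev eU eB b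
  | FAnd a b => @sat k G ev eU eB a && @sat k G ev eU eB b
  | FNot a => ~~ @sat k G ev eU eB a
  | FImp a b => @sat k G ev eU eB a ==> @sat k G ev eU eB b
  | FAllV i a => [forall v : 'I_(nv G), @sat k G (upd ev i (val v)) eU eB a]
  | FExV i a => [exists v : 'I_(nv G), @sat k G (upd ev i (val v)) eU eB a]
  | FAllU i a => [forall U : {set 'I_(nv G)}, @sat k G ev (upd eU i U) eB a]
  | FExU i a => [exists U : {set 'I_(nv G)}, @sat k G ev (upd eU i U) eB a]
  | FAllB i a => [forall B : {set 'I_(nv G) * 'I_(nv G)},
                   (B \subset edge_set G) ==> @sat k G ev eU (upd eB i B) a]
  | FExB i a => [exists B : {set 'I_(nv G) * 'I_(nv G)},
                   (B \subset edge_set G) && @sat k G ev eU (upd eB i B) a]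
  end.

Arguments sat {k} G ev eU eB phi.

Local Open Scope ring_scope.
Fixpoint mpoly (K : idomainType) (t : nat) : idomainType :=
  if t is t'.+1 then ({poly mpoly K t'} : idomainType) else K.

Fixpoint mvar (K : idomainType) (t : nat) (i : nat) : mpoly K t :=
  match t return mpoly K t with
  | 0 => 0
  | t'.+1 => if i == t' then ('X : {poly mpoly K t'}) else (mvar K t' i)%:P
  end.

Definition ratfun (K : idomainType) (t : nat) : fieldType := {fraction (mpoly K t)}.

(* indeterminate X_i (0-based, i < t) *)
Definition Xvar (K : idomainType) (t i : nat) : ratfun K t :=
  FracField.tofrac (mvar K t i).

(* An MSOL-polynomial is given by (l, m, l', m', Phi) with l' <= l, m' <= m;
   the free set variables of Phi are U_0..U_{l-1} and B_0..B_{m-1}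
   (free vertex variables, if any, are interpreted by 0), and its
   indeterminates are X_0..X_{l'+m'-1}. *)
Definition msol_poly_val (K : idomainType) (l m l' m' : nat) (Phi : msol)
    k (G : kgraph k) : ratfun K (l' + m')%N :=
  \sum_(U : {ffun 'I_l -> {set 'I_(nv G)}})
   \sum_(B : {ffun 'I_m -> {set 'I_(nv G) * 'I_(nv G)}}
        | [forall j, B j \subset edge_set G] &&
          sat G (fun _ => 0%N)
              (fun i => if insub i is Some o then U o else set0)
              (fun i => if insub i is Some o then B o else set0) Phi)
     ((\prod_(i < l | (i < l')%N) Xvar K (l' + m')%N i ^+ #|U i|) *
      (\prod_(j < m | (j < m')%N) Xvar K (l' + m')%N (l' + j)%N ^+ #|B j|)).

Definition C_finite (K : fieldType) (a : nat -> K) : Prop :=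
  exists (s : nat) (c : 'I_s -> K),
    forall n, (s <= n)%N -> a (n + s)%N = \sum_(i < s) c i * a (n + i)%N.

Definition C2_finite (K : fieldType) (a : nat -> K) : Prop :=
  exists (s : nat) (c : 'I_s.+1 -> nat -> K),
    (forall i, C_finite (c i)) /\
    (forall n, c ord_max n != 0) /\
    (forall n, (s <= n)%N ->
       c ord_max n * a (n + s)%N =
       \sum_(i < s) c (widen_ord (leqnSn s) i) n * a (n + i)%N).

(* Main.v *)
(** A decorated graph (a graph with an interpretation of the set variables) is
    read by a finite automaton whose letters are the basic operations together
    with the decoration of what the operation adds.  For an atomic formula the
    state is the set of realized types of ordered pairs of vertices; Boolean
    connectives are products, and a quantifier is a subset construction.  So
    [p(G)] is a linear functional of the vector [v(G)] of weighted numbers of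
    decorations reaching each state, and each operation acts on [v(G)] by a
    constant matrix.  Edge sets survive joins only if a join adds at most one
    edge between two given labels; for [eta^b] this is arranged by giving each
    vertex of a class of at most [b] vertices a label of its own, which also
    lets the state decide whether [eta^b] acts.

    Hence [a n = v n *m y] with [v n.+1 = v n *m (P *m M^n *m Q)].  Then
    [a (n + i) = v n *m f_i], where [f_i] is a vector of polynomials in the
    entries of [M^n].  By Hilbert's basis theorem some [f_s] is a polynomial
    combination of [f_0, ..., f_(s-1)], which is a recurrence for [a] with
    leading coefficient 1 and C-finite coefficients; in particular no
    Skolem-Mahler-Lech type argument is needed to keep the leading coefficient
    nonzero. *)

Require Import Defs.
From HB Require Import structures.
From mathcomp Require Import all_boot all_order all_algebra.
From mathcomp Require Import zify.
From Stdlib Require Import Classical.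
Set Implicit Arguments. Unset Strict Implicit. Unset Printing Implicit Defensive.
Import Order.TTheory GRing.Theory Num.Theory.

Local Open Scope ring_scope.

(** * Submodules of free modules over polynomial rings *)

Section Span.
Variables (R : comNzRingType) (V : lmodType R).

Inductive span (s : seq V) : V -> Prop :=
  | Span0 : span s 0
  | SpanDZ a x y : x \in s -> span s y -> span s (a *: x + y).

Definition submodule (I : V -> Prop) :=
  I 0 /\ forall a x y, I x -> I y -> I (a *: x + y).

Definition fin_gen (I : V -> Prop) :=
  exists s : seq V, (forall x, x \in s -> I x) /\ forall x, I x -> span s x.

Lemma span_mono s t x : {subset s <= t} -> span s x -> span t x.
Proof.
move=> st; elim=> [|a y z /st ys _ IH]; first exact: Span0.
exact: SpanDZ.
Qed.

Lemma spanD s x y : span s x -> span s y -> span s (x + y).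
Proof.
move=> sx sy; elim: sx => [|a u v us _ IH]; first by rewrite add0r.
by rewrite -addrA; apply: SpanDZ.
Qed.

Lemma spanZ s a x : span s x -> span s (a *: x).
Proof.
elim=> [|b u v us _ IH]; first by rewrite scaler0; apply: Span0.
by rewrite scalerDr scalerA; apply: SpanDZ.
Qed.

Lemma span_mem (s : seq V) x : x \in s -> span s x.
Proof.
by move=> xs; rewrite -[x]scale1r -[_ *: _]addr0; apply: SpanDZ => //; apply: Span0.
Qed.

Lemma submodule_span I s x :
  submodule I -> (forall y, y \in s -> I y) -> span s x -> I x.
Proof.
by move=> [I0 IDZ] sI; elim=> // a y z ys _ IH; apply: IDZ => //; apply: sI.
Qed.

Lemma submodule_spanP s : submodule (span s).
Proof.
split; first exact: Span0.
by move=> a x y sx sy; apply: spanD => //; apply: spanZ.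
Qed.

Lemma span_mkseq (f : nat -> V) n x : span (mkseq f n) x ->
  exists c : nat -> R, x = \sum_(i < n) c i *: f i.
Proof.
elim=> [|a y z /mapP [i]]; first by exists (fun=> 0); rewrite big1 // => i _; rewrite scale0r.
rewrite mem_iota => /= lt_in -> _ [c ->].
exists (fun j => (if j == i then a else 0) + c j).
under [RHS]eq_bigr do rewrite scalerDl; rewrite big_split /=; congr (_ + _).
rewrite (bigD1 (Ordinal lt_in)) //= eqxx big1 ?addr0 // => j /eqP ji.
by case: eqP => [e|_]; [case: ji; apply: val_inj | rewrite scale0r].
Qed.

(** The elements spanned by initial segments of [f] form a submodule. Its finitely many generators
    all lie in the span of one initial segment, of length [n] say, and then so does [f n]. *)
Lemma ascending_chain (f : nat -> V) :
    (forall I, submodule I -> fin_gen I) ->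
  exists n (c : nat -> R), f n = \sum_(i < n) c i *: f i.
Proof.
move=> fg; pose I x := exists n, span (mkseq f n) x.
have monof m n x : (m <= n)%N -> span (mkseq f m) x -> span (mkseq f n) x.
  move=> mn; apply: span_mono => y /mapP [i]; rewrite mem_iota /= => im ->.
  by apply: map_f; rewrite mem_iota /=; apply: leq_trans mn.
have subI : submodule I.
  split; first by exists 0%N; apply: Span0.
  move=> a x y [n xn] [m ym]; exists (maxn n m).
  by apply: (submodule_spanP _).2; [apply: monof xn | apply: monof ym];
     rewrite ?leq_maxl ?leq_maxr.
have [s [sI Is]] := fg _ subI.
have [n sn] : exists n, forall x, x \in s -> span (mkseq f n) x.
  elim: s sI {Is} => [|y s IH] sI; first by exists 0%N.
  have [|n sn] := IH; first by move=> x xs; apply: sI; rewrite inE xs orbT.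
  have [m ym] := sI y (mem_head _ _); exists (maxn n m) => x.
  rewrite inE => /predU1P [-> | /sn]; last by apply: monof; apply: leq_maxl.
  by apply: monof ym; apply: leq_maxr.
exists n; apply: span_mkseq; apply: submodule_span (submodule_spanP _) sn _.
by apply: Is; exists n.+1; apply: span_mem; apply: map_f; rewrite mem_iota /=.
Qed.

End Span.

(** Stated for row spaces of every length rather than for ideals: this form passes directly to
    polynomial rings, and it is the one applied to vectors of polynomials. *)
Definition noetherian (R : comNzRingType) :=
  forall r (I : 'rV[R]_r -> Prop), submodule I -> fin_gen I.

(** A vector of [I] outside the row space of independent rows of [I] raises the rank by one, and
    there are no [r.+1] independent rows of length [r]. *)
Lemma noetherian_field (K : fieldType) : noetherian K.
Proof.
move=> r I [I0 IDZ].
have step n : fin_gen I \/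
    exists A : 'M[K]_(n, r), (forall i, I (row i A)) /\ \rank A = n.
  elim: n => [|n [|[A [IA rA]]]]; [right | by left |].
    by exists 0; split=> [[]//|]; rewrite mxrank0.
  case: (classic (forall x, I x -> (x <= A)%MS)) => [IsA | nIsA]; [left | right].
    exists [seq row i A | i <- enum 'I_n]; split=> [x /mapP [i _ ->]|x /IsA /submxP [u ->]] //.
    rewrite mulmx_sum_row.
    elim/big_ind: _ => [|*|i _]; [exact: Span0 | exact: spanD|].
    by apply/spanZ/span_mem/map_f; rewrite mem_enum.
  have [x /(imply_to_and (I x)) [Ix nxA]] := not_all_ex_not _ _ nIsA.
  exists (col_mx x A); split=> [i|].
    case: (@splitP 1 n i) => j e.
      have ->: i = lshift n j by apply: val_inj.
      by rewrite (@rowKu _ 1) [j]ord1 row_id.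
    have ->: i = rshift 1 j by apply: val_inj.
    by rewrite (@rowKd _ 1).
  have lt_rank : (\rank A < \rank (col_mx x A))%N.
    rewrite -(addsmxE x A); apply: rank_ltmx.
    by rewrite /ltmx addsmxSr addsmx_sub submx_refl andbT; apply/negP.
  by apply/eqP; rewrite eqn_leq rank_leq_row /=; rewrite rA in lt_rank.
have [//|[A [_ rA]]] := step r.+1.
by have := rank_leq_col A; rewrite rA ltnn.
Qed.

(** * Hilbert's basis theorem for submodules of free modules *)

Section Hilbert.
Variable R : comNzRingType.
Variable r : nat.
Notation W := 'rV[R]_r.
Notation V := 'rV[{poly R}]_r.

Let coefv d (p : V) : W := \row_j (p 0 j)`_d.
Let deglt d (p : V) := forall j, (size (p 0%R j) <= d)%N.

Let coefvDZ d a p q : coefv d (a%:P *: p + q) = a *: coefv d p + coefv d q.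
Proof. by apply/rowP => j; rewrite !mxE coefD coefCM. Qed.

Let degltDZ d (a : {poly R}) e p q : (size a + e <= d.+1)%N ->
  deglt e p -> deglt d q -> deglt d (a *: p + q).
Proof.
move=> ae pe qd j; rewrite !mxE.
apply: leq_trans (size_polyD _ _) _; rewrite geq_max qd andbT.
apply: leq_trans (size_polyMleq _ _) _; rewrite -ltnS.
have := pe j; case: (size a + _)%N (leq_add (leqnn (size a)) (pe j)) => [|u] h _ //=.
exact: leq_trans h ae.
Qed.

(** Coefficient vectors at degree [d] of the elements of [I] of degree at most [d]. The coefficient
    vector may vanish, which makes this a submodule. *)
Let lead (I : V -> Prop) d (w : W) := exists p, [/\ I p, deglt d.+1 p & coefv d p = w].

Let leadZX d D p : (d <= D)%N -> deglt d.+1 p ->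
  deglt D.+1 ('X^(D - d) *: p) /\ coefv D ('X^(D - d) *: p) = coefv d p.
Proof.
move=> dD pd; split.
  rewrite -[X in deglt _ X]addr0; apply: degltDZ pd _ => [|j].
    by rewrite size_polyXn addSn addnS subnK.
  by rewrite mxE size_poly0.
by apply/rowP => j; rewrite !mxE coefXnM ltnNge leq_subr /= subKn.
Qed.

Let lead_mono I d D w : submodule I -> (d <= D)%N -> lead I d w -> lead I D w.
Proof.
move=> [I0 IDZ] dD [p [Ip pd <-]]; have [h1 h2] := leadZX dD pd.
exists ('X^(D - d) *: p); split=> //.
by rewrite -[_ *: _]addr0; apply: IDZ.
Qed.

Let lead_submodule I d : submodule I -> submodule (lead I d).
Proof.
move=> [I0 IDZ]; split.
  exists 0; split=> // [j|]; first by rewrite mxE size_poly0.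
  by apply/rowP => j; rewrite !mxE coef0.
move=> a _ _ [p [Ip pd <-]] [q [Iq qd <-]]; exists (a%:P *: p + q); split.
- exact: IDZ.
- apply: degltDZ pd qd.
  by rewrite -[d.+2]add1n leq_add2r size_polyC leq_b1.
- exact: coefvDZ.
Qed.

(** This is the division step: in degree [d] the top coefficient vector of an element of [I] can be
    cancelled by an element of the span of [s] without raising the degree. *)
Let covers (s : seq V) (I : V -> Prop) d := forall p, I p -> deglt d.+1 p ->
  exists q, [/\ span s q, deglt d.+1 q & coefv d q = coefv d p].

(** Each coefficient vector in [t] is realized by an element of [I] of degree at most [D];
    multiplying that element by ['X^(d - D)] serves every degree [d] from [D] on. *)
Let covers_lead I D t : submodule I ->
    (forall w, w \in t -> lead I D w) ->
  exists s, (forall x, x \in s -> I x) /\ forall d, (D <= d)%N ->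
    (forall w, lead I d w -> span t w) -> covers s I d.
Proof.
move=> subI tI.
have [s [sI st]] : exists s : seq V, (forall x, x \in s -> I x) /\
    forall w, w \in t -> exists p, [/\ p \in s, deglt D.+1 p & coefv D p = w].
  elim: t tI => [|w t IH] tI; first by exists [::].
  have [|s [sI st]] := IH; first by move=> x xs; apply: tI; rewrite inE xs orbT.
  have [p [Ip pd pw]] := tI w (mem_head _ _).
  exists (p :: s); split=> [x|x]; rewrite inE => /predU1P [-> // | xs].
  - exact: sI.
  - by exists p; rewrite mem_head.
  - by have [q [qs *]] := st x xs; exists q; rewrite inE qs orbT.
exists s; split=> // d Dd leadt p Ip pd.
have : span t (coefv d p) by apply: leadt; exists p.
elim=> [|a w v /st [u [us ud uw]] _ [q [sq qd qv]]].
  exists 0; split; first exact: Span0.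
    by move=> j; rewrite mxE size_poly0.
  by apply/rowP => j; rewrite !mxE coef0.
have [h1 h2] := leadZX Dd ud.
exists (a%:P *: ('X^(d - D) *: u) + q); split.
- by apply: spanD => //; do 2!apply: spanZ; apply: span_mem.
- by apply: degltDZ h1 qd; rewrite -[d.+2]add1n leq_add2r size_polyC leq_b1.
- by rewrite coefvDZ h2 uw qv.
Qed.

(** The leading coefficient vectors of all degrees are generated by finitely many, all realized at a
    common degree [D]. This covers the degrees from [D] on; each of the finitely many lower degrees
    gets generators of its own, and repeated division brings every element of [I] down to 0. *)
Lemma hilbert_basis_rows : (forall I : W -> Prop, submodule I -> fin_gen I) ->
  forall I : V -> Prop, submodule I -> fin_gen I.
Proof.
move=> fgW I subI.
have leadAll : submodule (fun w => exists d, lead I d w).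
  split; first by exists 0%N; apply: (lead_submodule _ subI).1.
  move=> a x y [d xd] [e ye]; exists (maxn d e).
  by apply: (lead_submodule _ subI).2; [apply: lead_mono xd | apply: lead_mono ye];
     rewrite ?leq_maxl ?leq_maxr.
have [t [tI It]] := fgW _ leadAll.
have [D tD] : exists D, forall w, w \in t -> lead I D w.
  elim: t tI {It} => [|w t IH] tI; first by exists 0%N.
  have [|D tD] := IH; first by move=> x xs; apply: tI; rewrite inE xs orbT.
  have [d wd] := tI w (mem_head _ _); exists (maxn D d) => x.
  rewrite inE => /predU1P [-> | /tD]; last by apply: lead_mono => //; apply: leq_maxl.
  by apply: lead_mono wd => //; apply: leq_maxr.
have [s0 [s0I s0P]] := covers_lead subI tD.
have covers_mono s s' d : {subset s <= s'} -> covers s I d -> covers s' I d.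
  move=> ss' cs p Ip pd; have [q [sq *]] := cs p Ip pd.
  by exists q; split=> //; apply: span_mono sq.
have [s [sI sP]] : exists s, (forall x, x \in s -> I x) /\ forall d, covers s I d.
  have [s1 [s1I s1P]] : exists s, (forall x, x \in s -> I x) /\
      forall d, (d < D)%N -> covers s I d.
    elim: (D) => [|E [s [sI sP]]]; first by exists [::].
    have [u [uI Iu]] := fgW _ (lead_submodule E subI).
    have [s' [s'I s'P]] := covers_lead subI uI.
    exists (s ++ s'); split=> [x|d].
      by rewrite mem_cat => /orP [/sI | /s'I].
    rewrite ltnS leq_eqVlt => /predU1P [-> | dE].
      apply: covers_mono (s'P E (leqnn _) Iu) => x xs.
      by rewrite mem_cat xs orbT.
    by apply: covers_mono (sP d dE) => x xs; rewrite mem_cat xs.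
  exists (s0 ++ s1); split=> [x|d].
    by rewrite mem_cat => /orP [/s0I | /s1I].
  have [Dd|dD] := leqP D d.
    apply: covers_mono (s0P d Dd _) => [x xs | w wd]; first by rewrite mem_cat xs.
    by apply: It; exists d.
  by apply: covers_mono (s1P d dD) => x xs; rewrite mem_cat xs orbT.
exists s; split=> // p Ip.
have [d pd] : exists d, deglt d p.
  exists (\max_j size (p 0%R j))%N => j.
  exact: (@leq_bigmax _ (fun j => size (p 0 j))).
elim: d p Ip pd => [|d IH] p Ip pd.
  suff -> : p = 0 by apply: Span0.
  by apply/rowP => j; rewrite mxE; apply/eqP; rewrite -size_poly_leq0.
have [q [sq qd qp]] := sP d p Ip pd.
rewrite -[p](subrK q); apply: spanD => //; apply: IH.
  rewrite addrC -scaleN1r; apply: subI.2 => //.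
  exact: submodule_span subI sI sq.
move=> j; rewrite !mxE; apply/leq_sizeP => i; rewrite leq_eqVlt => /predU1P [<-|di].
  by rewrite coefB; have /rowP /(_ j) := qp; rewrite !mxE => ->; rewrite subrr.
rewrite coefB !nth_default ?subrr //; [exact: leq_trans (qd j) di | exact: leq_trans (pd j) di].
Qed.

End Hilbert.

Lemma noetherian_mpoly (K : fieldType) t : noetherian (mpoly K t).
Proof.
elim: t => [|t IH]; first exact: noetherian_field.
by move=> r; apply: hilbert_basis_rows; apply: IH.
Qed.

(** * Linear recurrences *)

Section LinearSequences.
Variable K : fieldType.

(** Matrix form of C-finiteness, in which closure under sums and products is a block-diagonal and a
    tensor construction. *)
Definition linear_seq (a : nat -> K) :=
  exists d (A : 'M[K]_d) (w : nat -> 'rV_d) (y : 'cV_d),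
    (forall n, w n.+1 = w n *m A) /\ forall n, a n = (w n *m y) 0 0.

Lemma linear_seq_ext a b : a =1 b -> linear_seq a -> linear_seq b.
Proof.
move=> ab [d [A [w [y [wA aw]]]]].
by exists d, A, w, y; split=> // n; rewrite -ab.
Qed.

Lemma linear_seq_cst c : linear_seq (fun=> c).
Proof. by exists 1%N, 1%:M, (fun=> c%:M), 1%:M; split=> n; rewrite mulmx1 // mxE eqxx mulr1n. Qed.

Lemma linear_seqD a b : linear_seq a -> linear_seq b -> linear_seq (fun n => a n + b n).
Proof.
move=> [d [A [w [y [wA aw]]]]] [e [B [u [z [uB bu]]]]].
exists (d + e)%N, (block_mx A 0 0 B), (fun n => row_mx (w n) (u n)), (col_mx y z).
split=> n; last by rewrite mul_row_col mxE aw bu.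
by rewrite mul_row_block !mulmx0 addr0 add0r wA uB.
Qed.

Lemma linear_seqM a b : linear_seq a -> linear_seq b -> linear_seq (fun n => a n * b n).
Proof.
move=> [d [A [w [y [wA aw]]]]] [e [B [u [z [uB bu]]]]].
(* The tensor product of [w n] and [u n] is the flattened matrix [(w n)^T *m u n], and
   [X |-> A^T *m X *m B] advances both factors. *)
exists (d * e)%N, (lin_mulmx A^T *m lin_mulmxr B), (fun n => mxvec ((w n)^T *m u n)),
  (mxvec (y *m z^T))^T.
split=> n.
  by rewrite mulmxA !mul_vec_lin /= mulmxA -trmx_mul -mulmxA wA uB.
rewrite mxvec_dotmul mulmxA -mulmxA -trmx_mul.
by rewrite mxE big_ord1 -aw mxE -bu.
Qed.

Lemma linear_seq_sum I (s : seq I) (P : pred I) (a : I -> nat -> K) :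
  (forall i, linear_seq (a i)) -> linear_seq (fun n => \sum_(i <- s | P i) a i n).
Proof.
move=> la; elim: s => [|i s IH].
  by apply: linear_seq_ext (linear_seq_cst 0) => n; rewrite big_nil.
apply: (@linear_seq_ext (fun n => (if P i then a i n else 0) +
    \sum_(i <- s | P i) a i n)) => [n|].
  by rewrite big_cons; case: (P i); rewrite ?add0r.
by apply: linear_seqD => //; case: (P i) => //; apply: linear_seq_cst.
Qed.

Lemma linear_seqX a k : linear_seq a -> linear_seq (fun n => a n ^+ k).
Proof.
move=> la; elim: k => [|k IH]; first exact: (linear_seq_cst 1).
by apply: linear_seq_ext (linear_seqM la IH) => n; rewrite exprS.
Qed.

(** Some [A^s *m y] is a combination of the earlier ones, because subspaces of a finite-dimensional
    space are finitely generated; multiplying this relation by [w n] gives the recurrence. *)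
Lemma linear_seq_C_finite a : linear_seq a -> C_finite a.
Proof.
move=> [d [A [w [y [wA aw]]]]].
have wi n i : w (n + i)%N = w n *m iter i (mulmx A) 1%:M.
  elim: i n => [|i IH] n; first by rewrite addn0 mulmx1.
  by rewrite addnS -addSn IH wA /= mulmxA.
have [s [c cs]] := @ascending_chain K _ (fun i => (iter i (mulmx A) 1%:M *m y)^T)
  (@noetherian_field K d).
exists s, (fun i => c i) => n _.
rewrite aw wi -mulmxA; move/(congr1 trmx): cs; rewrite trmxK => ->.
rewrite linear_sum /= mulmx_sumr summxE; apply: eq_bigr => i _.
by rewrite linearZ /= trmxK -scalemxAr mxE aw wi mulmxA.
Qed.

Fixpoint mcst t : {rmorphism K -> mpoly K t} :=
  match t return {rmorphism K -> mpoly K t} with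
  | 0 => idfun
  | t'.+1 => (@polyC (mpoly K t') : {rmorphism _ -> _}) \o (mcst t')
  end.

(** Evaluation at the point [rho]. The outermost variable has the largest index, as in [mvar]. *)
Fixpoint meval t (rho : nat -> K) : {rmorphism mpoly K t -> K} :=
  match t return {rmorphism mpoly K t -> K} with
  | 0 => idfun
  | t'.+1 => (horner_eval (rho t') : {rmorphism {poly K} -> K}) \o
      (map_poly (meval t' rho) : {rmorphism {poly mpoly K t'} -> {poly K}})
  end.

Lemma mevalC t rho c : meval t rho (mcst t c) = c.
Proof.
elim: t => //= t IH.
by rewrite map_polyC /= /horner_eval hornerC IH.
Qed.

Lemma mevalX t rho i : (i < t)%N -> meval t rho (mvar K t i) = rho i.
Proof.
elim: t => //= t IH; rewrite ltnS leq_eqVlt => /predU1P [-> | lt_it].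
  by rewrite eqxx map_polyX /horner_eval hornerX.
by rewrite (ltn_eqF lt_it) map_polyC /horner_eval hornerC; apply: IH.
Qed.

Lemma linear_seq_meval t (rho : nat -> nat -> K) p :
  (forall k, linear_seq (rho^~ k)) -> linear_seq (fun n => meval t (rho n) p).
Proof.
move=> lrho; elim: t p => [|t IH] p; first exact: linear_seq_cst.
apply: (@linear_seq_ext (fun n => \sum_(i < size (p : {poly mpoly K t}))
    meval t (rho n) (p : {poly _})`_i * rho n t ^+ i)) => [n|]; last first.
  by apply: linear_seq_sum => i; apply: linear_seqM => //; apply: linear_seqX.
rewrite /= /horner_eval.
rewrite (@horner_coef_wide _ (size (p : {poly mpoly K t}))) ?size_poly //.
by apply: eq_bigr => i _; rewrite coef_map.
Qed.

(** The entries of [M^n] become [r * r] indeterminates, so that a single relation between polynomial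
    vectors holds for all [n] at once after evaluation; its coefficients become polynomials in the
    entries of [M^n]. *)
Lemma C2_finite_matrix r (M P Q : 'M[K]_r) (v : nat -> 'rV_r) (y : 'cV_r) :
    (forall n, v n.+1 = v n *m (P *m iter n (mulmx M) 1%:M *m Q)) ->
  C2_finite (fun n => (v n *m y) 0 0).
Proof.
set pw := fun n => iter n (mulmx M) 1%:M => vS.
have pwD n j : pw (n + j)%N = pw n *m pw j.
  by elim: n => [|n IH]; rewrite ?mul1mx // /pw addSn /= -/(pw _) IH mulmxA.
pose t := (r * r)%N.
pose rho n k := if insub k is Some o then mxvec (pw n) 0 (o : 'I_t) else 0.
pose X := \matrix_(i, j) mvar K t (mxvec_index i j) : 'M[mpoly K t]_r.
have evX n : map_mx (meval t (rho n)) X = pw n.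
  by apply/matrixP => i j; rewrite !mxE mevalX // /rho valK mxvecE.
have evC n m1 m2 (A : 'M_(m1, m2)) : map_mx (meval t (rho n)) (map_mx (mcst t) A) = A.
  by apply/matrixP => i j; rewrite !mxE mevalC.
(* The indeterminates stand for the entries of [pw n], whereas after [j] steps the power to apply is
   [pw (n + j) = pw n *m pw j]. Hence [j] is carried along and [pw j] enters as a constant
   matrix. *)
pose F := fix F (i j : nat) {struct i} : 'cV[mpoly K t]_r := if i is i'.+1 then
  map_mx (mcst t) P *m X *m map_mx (mcst t) (pw j *m Q) *m F i' j.+1
  else map_mx (mcst t) y.
have FE n i j : v (n + j + i)%N *m y = v (n + j)%N *m map_mx (meval t (rho n)) (F i j).
  elim: i j => [|i IH] j /=; first by rewrite addn0 evC.
  rewrite addnS -addSn -addnS IH !map_mxM !evC evX addnS vS -/(pw _) pwD.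
  by rewrite !mulmxA.
have [s [g gs]] := @ascending_chain _ _ (fun i => (F i 0)^T) (@noetherian_mpoly K t r).
pose c (i : 'I_s.+1) n := if (i == s :> nat) then 1 else meval t (rho n) (g i).
exists s, c; split=> [i|]; last split=> [n|n _].
- apply: linear_seq_C_finite; rewrite /c; case: (_ == _); first exact: linear_seq_cst.
  apply: linear_seq_meval => k; rewrite /rho; case: insubP => [o _ _|_]; last exact: linear_seq_cst.
  case/mxvec_indexP: o => a b.
  exists r, M, (fun n => row a (pw n)), (delta_mx b 0); split=> n.
    rewrite -row_mul; congr row; rewrite -addn1 pwD; congr (_ *m _).
    by rewrite /pw /= mulmx1.
  by rewrite mxvecE -colE !mxE.
- by rewrite /c eqxx oner_neq0.
have vF i : (v (n + i)%N *m y) = v n *m map_mx (meval t (rho n)) (F i 0).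
  by have := FE n i 0%N; rewrite addn0.
rewrite {1}/c eqxx mul1r vF; move/(congr1 trmx): gs; rewrite trmxK => ->.
rewrite linear_sum /= map_mx_sum mulmx_sumr summxE; apply: eq_bigr => i _.
rewrite linearZ /= trmxK map_mxZ -scalemxAr mxE vF /c /=.
by rewrite (ltn_eqF (ltn_ord i)).
Qed.

End LinearSequences.

Local Close Scope ring_scope.

(** * Finite automata on decorated graphs *)

Definition inset n (U : {set 'I_n}) (x : nat) := [exists v : 'I_n, (val v == x) && (v \in U)].

(** Edge sets consist of ordered pairs, but membership of an edge ignores orientation; this is the
    relation tested by [FInB]. *)
Definition symrel n (B : {set 'I_n * 'I_n}) (x y : nat) :=
  [exists p in B, ((val p.1 == x) && (val p.2 == y)) || ((val p.1 == y) && (val p.2 == x))].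

Lemma insetE n (U : {set 'I_n}) (v : 'I_n) : inset U v = (v \in U).
Proof.
apply/existsP/idP => [[w /andP [/eqP e wU]]|vU]; last by exists v; rewrite eqxx.
by rewrite -(val_inj e).
Qed.

Lemma symrelE n (B : {set 'I_n * 'I_n}) (u v : 'I_n) :
  symrel B u v = ((u, v) \in B) || ((v, u) \in B).
Proof.
apply/existsP/orP => [[[a b] /= /andP [abB /orP [] /andP [/eqP e1 /eqP e2]]]|[] h].
- by left; rewrite -(val_inj e1) -(val_inj e2).
- by right; rewrite -(val_inj e1) -(val_inj e2).
- by exists (u, v); rewrite h /= !eqxx.
- by exists (v, u); rewrite h /= !eqxx orbT.
Qed.

Section Regular.
Variable Lam : finType.

(* [dX (false, i)] interprets the vertex variable [i], as a singleton, and
   [dX (true, j)] the set variable [j]; only values below [dn] matter. *)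
Record dgraph := DGraph {
  dn : nat;
  dl : nat -> Lam;
  dE : rel nat;
  dX : bool * nat -> pred nat;
  dB : nat -> rel nat }.

(* [LAdd f a c] relabels by [f], then adds a vertex with label [a] and colours
   [c]; [LEta R C] joins the pairs of labels in [R] and puts the edges it
   creates into the edge sets prescribed by [C]. *)
Inductive letter :=
  | LAdd of (Lam -> Lam) & Lam & (bool * nat -> bool)
  | LRen of (Lam -> Lam)
  | LEta of rel Lam & (nat -> rel Lam)
  | LDel of rel Lam.

Definition act (s : letter) (D : dgraph) : dgraph :=
  match s with
  | LAdd f a c => DGraph (dn D).+1
      (fun x => if x == dn D then a else f (dl D x))
      (fun x y => [&& dE D x y, x < dn D & y < dn D])
      (fun i x => if x == dn D then c i else dX D i x)
      (fun l x y => [&& dB D l x y, x < dn D & y < dn D])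
  | LRen f => DGraph (dn D) (fun x => f (dl D x)) (dE D) (dX D) (dB D)
  | LEta R C => DGraph (dn D) (dl D)
      (fun x y => dE D x y || (x != y) && R (dl D x) (dl D y)) (dX D)
      (fun l x y => dB D l x y ||
         [&& x != y, ~~ dE D x y, R (dl D x) (dl D y) & C l (dl D x) (dl D y)])
  | LDel R => DGraph (dn D) (dl D)
      (fun x y => dE D x y && ~~ R (dl D x) (dl D y)) (dX D)
      (fun l x y => dB D l x y && ~~ R (dl D x) (dl D y))
  end.

(** The equality of decorated graphs that automata must respect; it leaves the values beyond [dn]
    free. *)
Definition deq (D D' : dgraph) := [/\ dn D = dn D',
  forall x, x < dn D -> dl D x = dl D' x,
  forall x y, x < dn D -> y < dn D -> dE D x y = dE D' x y,
  forall i x, x < dn D -> dX D i x = dX D' i x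
  & forall l x y, x < dn D -> y < dn D -> dB D l x y = dB D' l x y].

(* Under a thin join the pair of labels of a new edge determines the edge, so
   that a letter can prescribe any set of new edges. *)
Definition thin (D : dgraph) (R : rel Lam) := forall x y t, x < dn D -> y < dn D ->
  R (dl D x) t -> dl D x = dl D y -> x = y.

(* [mode] is true when edge-set quantifiers are allowed. *)
Definition admissible (mode : bool) (D : dgraph) (s : letter) :=
  [/\ symmetric (dE D), irreflexive (dE D) &
   match s with
   | LEta R _ => symmetric R /\ (mode -> thin D R)
   | LDel R => symmetric R
   | _ => True
   end].

(** The state is a function of the decorated graph itself, not of a word building it; [step] has to
    predict how an admissible letter changes it. *)
Record automaton mode := Automaton {
  state : finType;
  run : dgraph -> state;
  step : state -> letter -> state;
  run_deq : forall D D', deq D D' -> run D = run D';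
  run_act : forall D s, admissible mode D s -> run (act s D) = step (run D) s }.

Definition regular mode (P : pred dgraph) :=
  exists (A : automaton mode) (acc : pred (state A)), forall D, P D = acc (run A D).

Lemma regular_deq mode P D D' : regular mode P -> deq D D' -> P D = P D'.
Proof. by move=> [A [acc e]] DD'; rewrite !e (run_deq A DD'). Qed.

Section PairTypes.
Variables (M : nat) (i j : bool * nat).

(** Recording only the edge sets of index below [M] and the colours [i] and [j] keeps the type
    finite. *)
Definition ptype : finType :=
  (Lam * Lam * (bool * bool) * bool * {ffun 'I_M -> bool} * (bool * bool))%type.

Definition pt D u v : ptype :=
  (dl D u, dl D v, (u < v, u == v), dE D u v, [ffun l : 'I_M => dB D l u v], (dX D i u, dX D j v)).

Definition ptypes D : {set ptype} := [set pt D p.1 p.2 | p : 'I_(dn D) * 'I_(dn D)].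

Lemma ptypesP D t :
  reflect (exists u v, [/\ u < dn D, v < dn D & t = pt D u v]) (t \in ptypes D).
Proof.
apply: (iffP imsetP) => [[[u v] _ ->]|[u [v [un vn ->]]]]; first by exists u, v.
by exists (Ordinal un, Ordinal vn).
Qed.

Lemma mem_ptypes D u v : u < dn D -> v < dn D -> pt D u v \in ptypes D.
Proof. by move=> un vn; apply/ptypesP; exists u, v. Qed.

Definition pt_map s (t : ptype) : ptype :=
  let: (a, b, (lt, eq), e, bl, x) := t in
  match s with
  | LAdd f _ _ | LRen f => (f a, f b, (lt, eq), e, bl, x)
  | LEta R C => (a, b, (lt, eq), e || ~~ eq && R a b,
      [ffun l : 'I_M => bl l || [&& ~~ eq, ~~ e, R a b & C l a b]], x)
  | LDel R => (a, b, (lt, eq), e && ~~ R a b, [ffun l : 'I_M => bl l && ~~ R a b], x)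
  end.

(* Types of pairs [(u, u)], i.e. types of single vertices. *)
Definition pt_diag (t : ptype) := let: (_, _, (_, eq), _, _, _) := t in eq.

Definition pt_newr f a (c : bool * nat -> bool) (t : ptype) : ptype :=
  let: (b, _, _, _, _, (xi, _)) := t in
  (f b, a, (true, false), false, [ffun=> false], (xi, c j)).

Definition pt_newl f a (c : bool * nat -> bool) (t : ptype) : ptype :=
  let: (_, b, _, _, _, (_, xj)) := t in
  (a, f b, (false, false), false, [ffun=> false], (c i, xj)).

Definition pt_new a (c : bool * nat -> bool) : ptype :=
  (a, a, (false, true), false, [ffun=> false], (c i, c j)).

Definition pt_step (T : {set ptype}) s : {set ptype} :=
  pt_map s @: T :|:
  if s is LAdd f a c then
    pt_new a c |: (pt_newr f a c @: [set t in T | pt_diag t]) :|: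
                  (pt_newl f a c @: [set t in T | pt_diag t])
  else set0.

Lemma ptypes_deq D D' : deq D D' -> ptypes D = ptypes D'.
Proof.
move=> [en el eE eX eB]; apply/setP => t; apply/ptypesP/ptypesP => -[u [v [un vn ->]]];
  exists u, v; rewrite ?en -?en //; rewrite -?en in un vn; split=> //.
  by rewrite /pt !el ?eE ?eX //; do 2!congr (_, _); apply/ffunP => l; rewrite !ffunE eB.
by rewrite /pt !el ?eE ?eX //; do 2!congr (_, _); apply/ffunP => l; rewrite !ffunE eB.
Qed.

Lemma pt_map_act s D u v : u < dn D -> v < dn D -> pt (act s D) u v = pt_map s (pt D u v).
Proof.
move=> un vn; case: s => [f a c|f|R C|R]; rewrite /pt /=.
- rewrite !(ltn_eqF un) !(ltn_eqF vn) un vn !andbT; do 2!congr (_, _).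
  by apply/ffunP => l; rewrite !ffunE !andbT.
- by [].
- by do 2!congr (_, _); apply/ffunP => l; rewrite !ffunE.
- by do 2!congr (_, _); apply/ffunP => l; rewrite !ffunE.
Qed.

(** The new type of an old pair depends only on its old type and the letter. The type of a pair
    containing the added vertex depends on the letter and on the type of the other vertex, which is
    visible as a diagonal type. *)
Lemma ptypes_act D s : ptypes (act s D) = pt_step (ptypes D) s.
Proof.
have old u v : u < dn D -> v < dn D -> pt (act s D) u v \in pt_step (ptypes D) s.
  move=> un vn; rewrite pt_map_act // inE; apply/orP; left; apply: imset_f.
  by apply/ptypesP; exists u, v.
have oldC t : t \in pt_map s @: ptypes D -> t \in ptypes (act s D).
  move=> /imsetP [_ /ptypesP [u [v [un vn ->]]] ->]; rewrite -pt_map_act //.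
  by apply/ptypesP; exists u, v; split=> //; case: (s) => //= *; rewrite ltnS ltnW.
apply/setP => t; apply/idP/idP; last first.
  rewrite inE => /orP [/oldC //|]; case: s {old oldC} => [f a c|f|R C|R]; try by rewrite inE.
  rewrite !inE => /orP [/orP [/eqP ->|]|].
  - apply/ptypesP; exists (dn D), (dn D); rewrite /= ltnSn; split=> //.
    rewrite /pt /= !eqxx ltnn !andbF; do 2!congr (_, _).
    by apply/ffunP => l; rewrite !ffunE !andbF.
  - move=> /imsetP [w]; rewrite inE => /andP [/ptypesP [u [v [un vn ->]]] _] ->.
    apply/ptypesP; exists u, (dn D); rewrite /= ltnS ltnW //; split=> //.
    rewrite /pt /= !eqxx !(ltn_eqF un) un ltnn !andbF; do 2!congr (_, _).
    by apply/ffunP => l; rewrite !ffunE !andbF.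
  move=> /imsetP [w]; rewrite inE => /andP [/ptypesP [u [v [un vn ->]]] _] ->.
  apply/ptypesP; exists (dn D), v; split=> //=; first by rewrite ltnS ltnW.
  rewrite /pt /= !eqxx !(gtn_eqF vn) !(ltn_eqF vn) ltnn (ltnNge (dn D)) (ltnW vn) /= !andbF; do 2!congr (_, _).
  by apply/ffunP => l; rewrite !ffunE !andbF.
move=> /ptypesP [u [v [un vn ->]]].
have [/andP [] |] := boolP ((u < dn D) && (v < dn D)); first exact: old.
case: s un vn {old oldC} => [f a c|f|R C|R] /= un vn; try by rewrite un vn.
have diag x : x < dn D -> pt D x x \in [set t0 in ptypes D | pt_diag t0].
  by move=> xn; rewrite inE /= eqxx andbT; apply/ptypesP; exists x, x.
rewrite negb_and -!leqNgt => nold; rewrite 3!inE; apply/orP; right.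
have [eu|nu] := eqVneq u (dn D); have [ev|nv] := eqVneq v (dn D).
- rewrite !inE; apply/orP; left; apply/orP; left; apply/eqP.
  rewrite /pt /= eu ev !eqxx ltnn !andbF; do 2!congr (_, _).
  by apply/ffunP => l; rewrite !ffunE !andbF.
- have vD : v < dn D by lia.
  rewrite inE; apply/orP; right; apply/imsetP; exists (pt D v v); first exact: diag.
  rewrite /pt /= eu !eqxx !(gtn_eqF vD) !(ltn_eqF vD) ltnn (ltnNge (dn D)) (ltnW vD) /= !andbF; do 2!congr (_, _).
  by apply/ffunP => l; rewrite !ffunE !andbF.
- have uD : u < dn D by lia.
  apply/orP; left; rewrite inE; apply/orP; right.
  apply/imsetP; exists (pt D u u); first exact: diag.
  rewrite /pt /= ev !eqxx !(ltn_eqF uD) uD ltnn !andbF; do 2!congr (_, _).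
  by apply/ffunP => l; rewrite !ffunE !andbF.
- by exfalso; lia.
Qed.

Definition pt_automaton mode : automaton mode :=
  @Automaton mode _ ptypes pt_step ptypes_deq (fun D s _ => ptypes_act D s).

End PairTypes.

End Regular.

(** * Closure of regular properties under Boolean connectives and quantifiers *)

Section Closure.
Variables (Lam : finType) (mode : bool).
Notation dgraph := (dgraph Lam).
Notation letter := (letter Lam).
Notation regular := (@regular Lam mode).

Lemma regular_ext (P P' : pred dgraph) : P =1 P' -> regular P -> regular P'.
Proof. by move=> PP' [A [acc e]]; exists A, acc => D; rewrite -PP'. Qed.

Lemma regular_not P : regular P -> regular (fun D => ~~ P D).
Proof. by move=> [A [acc e]]; exists A, (fun q => ~~ acc q) => D; rewrite e. Qed.

Program Definition prod_automaton (A B : automaton Lam mode) : automaton Lam mode :=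
  @Automaton _ _ (state A * state B)%type (fun D => (run A D, run B D))
    (fun q s => (step q.1 s, step q.2 s)) _ _.
Next Obligation. by rewrite (run_deq A H) (run_deq B H). Qed.
Next Obligation. by rewrite !run_act. Qed.

Lemma regular_or P P' : regular P -> regular P' -> regular (fun D => P D || P' D).
Proof.
move=> [A [acc e]] [A' [acc' e']].
by exists (prod_automaton A A'), (fun q => acc q.1 || acc' q.2) => D; rewrite e e'.
Qed.

Definition setX (D : dgraph) (k : bool * nat) (X : pred nat) : dgraph :=
  DGraph (dn D) (dl D) (dE D) (fun i => if i == k then X else dX D i) (dB D).

Definition letterX (k : bool * nat) (b : bool) (s : letter) : letter :=
  if s is LAdd f a c then LAdd f a (fun i => if i == k then b else c i) else s.

Definition is_add (s : letter) := if s is LAdd _ _ _ then true else false.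

Lemma dn_act D s : dn (act s D) = is_add s + dn D.
Proof. by case: s. Qed.

Lemma setX_deq D D' k X X' : deq D D' -> (forall x, x < dn D -> X x = X' x) ->
  deq (setX D k X) (setX D' k X').
Proof.
move=> [en el eE eX eB] XX'; split=> //= i x xn.
by case: eqP => _; [apply: XX' | apply: eX].
Qed.

(** Colours are fixed when a vertex is added, so the quantified set is extended by the bit [b] at an
    addition and stays as it is under every other letter. *)
Lemma act_setX D s k b X X' :
    (forall x, x < dn (act s D) -> X' x = if x == dn D then b else X x) ->
  deq (act (letterX k b s) (setX D k X)) (setX (act s D) k X').
Proof.
move=> XX'; have : forall x, x < dn (act s D) -> X' x = if is_add s && (x == dn D) then b else X x.
  by move=> x xn; rewrite XX' //; case: (s) xn => //= *; rewrite ltn_eqF.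
case: s {XX'} => [f a c|f|R C|R] /= XX'; split=> //= i x xn;
  by have [_|_] := eqVneq i k; rewrite ?XX'.
Qed.

Lemma admissible_setX D s k b X :
  admissible mode D s -> admissible mode (setX D k X) (letterX k b s).
Proof. by case: s. Qed.

Section ExV.
Variables (A : automaton Lam mode) (k : bool * nat).

(* The first component is the state as long as the quantified vertex has not
   been created. *)
Definition exV_run (D : dgraph) : state A * {set state A} :=
  (run A (setX D k xpred0), [set run A (setX D k (pred1 (val v))) | v : 'I_(dn D)]).

Definition exV_step (q : state A * {set state A}) (s : letter) : state A * {set state A} :=
  (step q.1 (letterX k false s),
   [set step q' (letterX k false s) | q' in q.2] :|:
   if is_add s then [set step q.1 (letterX k true s)] else set0).

Lemma exV_run_deq D D' : deq D D' -> exV_run D = exV_run D'.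
Proof.
move=> DD'; have [en _ _ _ _] := DD'; congr (_, _).
  by apply: run_deq; apply: setX_deq.
apply/setP => q; apply/imsetP/imsetP => -[v _ ->].
  have vn : v < dn D' by rewrite -en.
  by exists (Ordinal vn) => //; apply: run_deq; apply: setX_deq.
have vn : v < dn D by rewrite en.
by exists (Ordinal vn) => //; apply/esym/run_deq; apply: setX_deq.
Qed.

Lemma exV_run_act D s : admissible mode D s -> exV_run (act s D) = exV_step (exV_run D) s.
Proof.
move=> adm; rewrite /exV_run /exV_step; congr (_, _).
  rewrite -run_act; last exact: admissible_setX.
  by apply/esym/run_deq/act_setX => x _; case: eqP.
(* Here the chosen vertex is old, so a vertex added by the letter must not receive the colour
   [k]. *)
have old v : v < dn D -> run A (setX (act s D) k (pred1 v)) =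
    step (run A (setX D k (pred1 v))) (letterX k false s).
  move=> vn; rewrite -run_act; last exact: admissible_setX.
  by apply/esym/run_deq/act_setX => x _; case: eqP => // ->; rewrite /= gtn_eqF.
have new : is_add s -> run A (setX (act s D) k (pred1 (dn D))) =
    step (run A (setX D k xpred0)) (letterX k true s).
  move=> _; rewrite -run_act; last exact: admissible_setX.
  by apply/esym/run_deq/act_setX => x _; rewrite /=; case: eqP.
have leD : dn D <= dn (act s D) by case: (s) => //= *.
apply/setP => q; rewrite inE; apply/imsetP/orP => [[v _ ->]|[]].
- have [vn|nv] := ltnP v (dn D).
    by left; rewrite old //; apply: imset_f; apply/imsetP; exists (Ordinal vn).
  right; have [eD vD] : is_add s /\ val v = dn D.
    have vs := ltn_ord v; rewrite [X in _ < X]dn_act in vs.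
    by case: is_add vs => /= vs; lia.
  by rewrite eD vD inE new.
- move=> /imsetP [_ /imsetP [v _ ->] ->].
  have vn : v < dn (act s D) by apply: leq_trans leD.
  by exists (Ordinal vn) => //=; rewrite old.
- case: ifP => [ads|]; rewrite !inE // => /eqP ->.
  have vn : dn D < dn (act s D) by case: (s) ads.
  by exists (Ordinal vn) => //=; rewrite new.
Qed.

Definition exV_automaton := @Automaton _ mode _ exV_run exV_step exV_run_deq exV_run_act.

End ExV.

Lemma regular_exV P k : regular P ->
  regular (fun D => [exists v : 'I_(dn D), P (setX D k (pred1 (val v)))]).
Proof.
move=> [A [acc e]].
exists (exV_automaton A k), (fun q : state A * {set state A} => [exists q' in q.2, acc q']) => D.
apply/existsP/existsP => [[v]|[q /andP [/imsetP [v _ ->]]]].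
  rewrite e => h; exists (run A (setX D k (pred1 (val v)))); rewrite h andbT /=.
  by apply: imset_f.
by move=> h; exists v; rewrite e.
Qed.

Section ExU.
Variables (A : automaton Lam mode) (k : bool * nat).

Definition exU_run (D : dgraph) : {set state A} :=
  [set run A (setX D k (inset U)) | U : {set 'I_(dn D)}].

Definition exU_step (T : {set state A}) (s : letter) : {set state A} :=
  [set step q (letterX k b s) | q in T, b in [set: bool]].

(** Arbitrary predicates on [nat] replace sets over ['I_(dn D)], a type that changes with the
    graph. *)
Lemma exU_runP D q :
  reflect (exists X : pred nat, q = run A (setX D k X)) (q \in exU_run D).
Proof.
apply: (iffP imsetP) => [[U _ ->]|[X ->]]; first by exists (inset U).
exists [set v : 'I_(dn D) | X v] => //; apply: run_deq; apply: setX_deq => // x xn.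
by rewrite -[x]/(val (Ordinal xn)) insetE inE.
Qed.

Lemma exU_run_deq D D' : deq D D' -> exU_run D = exU_run D'.
Proof.
move=> DD'; apply/setP => q; apply/exU_runP/exU_runP => -[X ->]; exists X.
  by apply: run_deq; apply: setX_deq.
by apply/esym/run_deq; apply: setX_deq.
Qed.

Lemma exU_run_act D s : admissible mode D s -> exU_run (act s D) = exU_step (exU_run D) s.
Proof.
move=> adm; apply/setP => q; apply/exU_runP/imset2P => [[X ->]|[_ b /exU_runP [X ->] _ ->]].
  exists (run A (setX D k X)) (X (dn D)); rewrite ?inE //; first by apply/exU_runP; exists X.
  rewrite -run_act; last exact: admissible_setX.
  by apply/esym/run_deq/act_setX => x _; case: eqP => // ->.
exists (fun x => if x == dn D then b else X x).
rewrite -run_act; last exact: admissible_setX.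
exact/run_deq/act_setX.
Qed.

Definition exU_automaton := @Automaton _ mode _ exU_run exU_step exU_run_deq exU_run_act.

End ExU.

Lemma regular_exU P k : regular P ->
  regular (fun D => [exists U : {set 'I_(dn D)}, P (setX D k (inset U))]).
Proof.
move=> [A [acc e]].
exists (exU_automaton A k), (fun q : {set state A} => [exists q' in q, acc q']) => D.
apply/existsP/existsP => [[U]|[q /andP [/imsetP [U _ ->]]]].
  by rewrite e => h; exists (run A (setX D k (inset U))); rewrite h andbT imset_f.
by move=> h; exists U; rewrite e.
Qed.

Definition setB (D : dgraph) (l : nat) (W : rel nat) : dgraph :=
  DGraph (dn D) (dl D) (dE D) (dX D) (fun l' => if l' == l then W else dB D l').

(** [T] is a guess of the new edges that enter edge set [l]. It is symmetrized because edges are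
    unordered while label pairs are ordered. *)
Definition letterB (l : nat) (T : {set Lam * Lam}) (s : letter) : letter :=
  if s is LEta R C then
    LEta R (fun l' => if l' == l then (fun a b => ((a, b) \in T) || ((b, a) \in T)) else C l')
  else s.

Definition eset (D : dgraph) : {set 'I_(dn D) * 'I_(dn D)} :=
  [set p : 'I_(dn D) * 'I_(dn D) | (val p.1 < val p.2) && dE D (val p.1) (val p.2)].

Definition edge_rel (D : dgraph) (W : rel nat) := forall x y, x < dn D -> y < dn D ->
  W x y = W y x /\ (W x y -> (x != y) && dE D x y).

Lemma edge_rel_symrel D (B : {set 'I_(dn D) * 'I_(dn D)}) :
  symmetric (dE D) -> B \subset eset D -> edge_rel D (symrel B).
Proof.
move=> symE /subsetP BE x y xn yn.
rewrite -[x]/(val (Ordinal xn)) -[y]/(val (Ordinal yn)) !symrelE; split; first exact: orbC.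
case/orP => /BE; rewrite inE /= => /andP [lt e]; first by rewrite e ltn_eqF.
by rewrite symE e gtn_eqF.
Qed.

Lemma symrel_edge_rel D W : edge_rel D W ->
  exists2 B : {set 'I_(dn D) * 'I_(dn D)}, B \subset eset D &
    forall x y, x < dn D -> y < dn D -> symrel B x y = W x y.
Proof.
move=> eW; exists [set p : 'I_(dn D) * 'I_(dn D) | (val p.1 < val p.2) && W (val p.1) (val p.2)].
  apply/subsetP => -[u v]; rewrite !inE /= => /andP [-> Wuv].
  by have [_ /(_ Wuv) /andP [_ ->]] := eW u v (ltn_ord u) (ltn_ord v).
move=> x y xn yn; have [sW nW] := eW x y xn yn.
rewrite -[x]/(val (Ordinal xn)) -[y]/(val (Ordinal yn)) symrelE !inE /= -sW.
case: ltngtP => //= [|exy]; first by rewrite orbF.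
by case: (W x y) nW => // /(_ isT); rewrite exy eqxx.
Qed.

Lemma setB_deq D D' l W W' : deq D D' ->
    (forall x y, x < dn D -> y < dn D -> W x y = W' x y) ->
  deq (setB D l W) (setB D' l W').
Proof.
move=> [en el eE eX eB] WW'; split=> //= l' x y xn yn.
by case: eqP => _; [apply: WW' | apply: eB].
Qed.

Lemma admissible_setB D s l T W :
  admissible mode D s -> admissible mode (setB D l W) (letterB l T s).
Proof. by case: s. Qed.

Lemma act_setB D s l T W : admissible mode D s -> edge_rel D W ->
  exists2 W', edge_rel (act s D) W' &
    deq (act (letterB l T s) (setB D l W)) (setB (act s D) l W').
Proof.
move=> [symE irrE adm] eW; exists (dB (act (letterB l T s) (setB D l W)) l); last first.
  by case: s adm => [f a c|f|R C|R] _; split=> //= l' x y xn yn;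
    by have [_|_] := eqVneq l' l; rewrite ?eqxx.
case: s adm => [f a c|f|R C|R] /=; rewrite ?eqxx => adm x y /= xn yn.
- rewrite [(y < dn D) && _]andbC; have [/andP [xD yD]|_] := boolP ((x < dn D) && (y < dn D)); last by rewrite !andbF.
  have [sW nW] := eW x y xD yD; rewrite sW !andbT; split=> //.
  by rewrite -sW.
- exact: eW.
- have [sW nW] := eW x y xn yn; case: adm => symR _; split.
    by rewrite sW eq_sym symE symR orbC [in RHS]orbC; congr [|| [&& _, _, _ & _] | _]; rewrite orbC.
  case/orP => [/nW /andP [-> ->] //|/and4P [-> _ -> _]].
  by rewrite orbT.
- have [sW nW] := eW x y xn yn; rewrite sW adm; split=> // /andP [].
  by rewrite -sW => /nW /andP [-> ->]; rewrite adm.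
Qed.

(** [W] is the part of [W'] on old edges, and [T] collects the label pairs of the new ones. Under a
    thin join these pairs determine the edges, so that [T] adds nothing outside [W']. *)
Lemma setB_act D s l W' : admissible true D s -> edge_rel (act s D) W' ->
  exists T W, edge_rel D W /\
    deq (act (letterB l T s) (setB D l W)) (setB (act s D) l W').
Proof.
case=> symE irrE adm eW'.
have leD : dn D <= dn (act s D) by rewrite dn_act leq_addl.
pose T := [set p : Lam * Lam | [exists u : 'I_(dn D), [exists v : 'I_(dn D),
   [&& p == (dl D u, dl D v), W' u v & ~~ dE D u v]]]].
pose W x y := W' x y && dE D x y.
exists T, W; split.
  move=> x y xn yn; have [sW' nW'] := eW' x y (leq_trans xn leD) (leq_trans yn leD).
  rewrite /W sW' symE; split=> // /andP [].
  by rewrite -sW' => /nW' /andP [-> _] ->.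
case: s adm eW' leD @T @W => [f a c|f|R C|R] adm eW' _ T W; rewrite /= in adm eW'; split=> //= l' x y xn yn;
  case: eqP => // _.
- rewrite /W; have [_ nW'] := eW' x y xn yn; case: (W' x y) nW' => //= /(_ isT).
  by move=> /and4P [_ -> -> ->].
- by rewrite /W; have [_ nW'] := eW' x y xn yn; case: (W' x y) nW' => //= /(_ isT) /andP [].
- rewrite /W; have [sW' nW'] := eW' x y xn yn; have [symR /(_ isT) thinR] := adm.
  have [exy|nexy] /= := boolP (dE D x y); first by rewrite andbT andbF orbF.
  rewrite andbF /=; apply/idP/idP; last first.
    move=> Wxy; have /= := nW' Wxy; rewrite (negbTE nexy) /= => /andP [nxy /andP [_ Rxy]].
    rewrite nxy Rxy /=; apply/orP; left; rewrite inE.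
    apply/existsP; exists (Ordinal xn); apply/existsP; exists (Ordinal yn) => /=.
    by rewrite eqxx Wxy.
  case/and3P => nxy Rxy /orP []; rewrite inE => /existsP [u /existsP [v /and3P [/eqP [e1 e2] Wuv nuv]]].
    have eu : x = u by apply: (thinR _ _ (dl D y)).
    have ev : y = v by apply: (thinR _ _ (dl D x)) => //; rewrite symR.
    by rewrite eu ev.
  have eu : y = u by apply: (thinR _ _ (dl D x)) => //; rewrite symR.
  have ev : x = v by apply: (thinR _ _ (dl D y)).
  by rewrite sW' eu ev.
- rewrite /W; have [_ nW'] := eW' x y xn yn; case: (W' x y) nW' => //= /(_ isT).
  by move=> /and3P [_ -> ->].
Qed.

Section ExB.
Variables (A : automaton Lam mode) (l : nat).

Definition exB_run (D : dgraph) : {set state A} :=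
  [set run A (setB D l (symrel B)) | B : {set 'I_(dn D) * 'I_(dn D)} in powerset (eset D)].

Definition exB_step (Q : {set state A}) (s : letter) : {set state A} :=
  [set step q (letterB l T s) | q in Q, T in [set: {set Lam * Lam}]].

Lemma exB_runP D q : symmetric (dE D) ->
  reflect (exists2 W, edge_rel D W & q = run A (setB D l W)) (q \in exB_run D).
Proof.
move=> symE; apply: (iffP imsetP) => [[B]|[W eW ->]].
  by rewrite inE => BE ->; exists (symrel B) => //; apply: edge_rel_symrel.
have [B BE BW] := symrel_edge_rel eW.
by exists B; rewrite ?inE //; apply/esym/run_deq; apply: setB_deq.
Qed.

Lemma exB_run_deq D D' : deq D D' -> exB_run D = exB_run D'.
Proof.
move: D D' => [n dl1 dE1 X1 B1] [n' dl2 dE2 X2 B2] DD'.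
have [/= en _ eE _ _] := DD'; subst n'; rewrite /exB_run.
have -> : eset (DGraph n dl1 dE1 X1 B1) = eset (DGraph n dl2 dE2 X2 B2).
  by apply/setP => p; rewrite !inE /= eE.
by apply: eq_imset => B; apply: run_deq; apply: setB_deq.
Qed.

Lemma exB_run_act (modeT : mode) D s :
  admissible mode D s -> exB_run (act s D) = exB_step (exB_run D) s.
Proof.
move=> adm; have [symE irrE adm'] := adm.
have symE' : symmetric (dE (act s D)).
  case: s adm' {adm} => [f a c|f|R C|R] //= adm' x y; rewrite symE.
  - by rewrite [(y < _) && _]andbC.
  - by rewrite eq_sym adm'.1.
  - by rewrite adm'.
apply/setP => q; apply/exB_runP/imset2P => // [[W' eW' ->]|[q' T]].
  have admT : admissible true D s.
    by split=> //; case: (s) adm' => // R C [symR h]; split=> // _; apply: h.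
  have [T [W [eW TW]]] := setB_act l admT eW'.
  exists (run A (setB D l W)) T; rewrite ?inE //; first by apply/exB_runP => //; exists W.
  by rewrite -run_act; [rewrite (run_deq A TW) | apply: admissible_setB].
move=> /exB_runP -/(_ symE) [W eW ->] _ ->.
have [W' eW' TW] := act_setB l T adm eW.
by exists W' => //; rewrite -run_act; [rewrite (run_deq A TW) | apply: admissible_setB].
Qed.

Definition exB_automaton (modeT : mode) :=
  @Automaton _ mode _ exB_run exB_step exB_run_deq (exB_run_act modeT).

End ExB.

Lemma regular_exB P l : mode -> regular P ->
  regular (fun D => [exists B : {set 'I_(dn D) * 'I_(dn D)},
    (B \subset eset D) && P (setB D l (symrel B))]).
Proof.
move=> modeT [A [acc e]].
exists (exB_automaton A l modeT), (fun q : {set state A} => [exists q' in q, acc q']) => D.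
apply/existsP/existsP => [[B /andP [BE]]|[q /andP [/imsetP [B BE ->]]]].
  rewrite e => h; exists (run A (setB D l (symrel B))); rewrite h andbT.
  by apply: imset_f; rewrite inE.
by move=> h; exists B; rewrite e h andbT; rewrite inE in BE.
Qed.

(** * MSOL formulas define regular properties of decorated graphs *)

Definition decorate k (G : kgraph k) (lb : nat -> Lam) (ev : nat -> nat)
    (eU : nat -> {set 'I_(nv G)}) (eB : nat -> {set 'I_(nv G) * 'I_(nv G)}) : dgraph :=
  DGraph (nv G) lb (gedge G)
    (fun i x => if i.1 then inset (eU i.2) x else x == ev i.2) (fun l => symrel (eB l)).

Lemma regular_ptypes M i j (acc : pred {set ptype Lam M}) :
  regular (fun D => acc (ptypes M i j D)).
Proof. by exists (pt_automaton Lam M i j mode), acc. Qed.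

(** By induction on the formula: atomic formulas inspect only the realized pair types, and the other
    cases are the closure lemmas. The bound on [ev] says that variables denote vertices, with the
    value 0 on the empty graph. *)
Lemma sat_regular (phi : msol) : mode || no_edgeset phi -> exists2 P, regular P &
  forall k (G : kgraph k) lb ev eU eB, (forall i, ev i <= (nv G).-1) ->
    sat G ev eU eB phi = P (decorate lb ev eU eB).
Proof.
(* The flag [b] is the value on the empty graph, where all free vertex
   variables denote 0. *)
have atomic i j M (p : pred (ptype Lam M)) (b : bool) :
    regular (fun D => b && (dn D == 0) || [exists u : 'I_(dn D), [exists v : 'I_(dn D), p (pt M i j D u v)]]).
  apply: regular_ext (regular_ptypes i j (fun T => b && (T == set0) || [exists t in T, p t])) => D.
  congr (_ && _ || _).
    apply/eqP/eqP => [T0|D0]; last first.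
      by apply/setP => t; rewrite inE; apply/ptypesP => -[u [v []]]; rewrite D0.
    case: (posnP (dn D)) => // D0; have : pt M i j D 0 0 \in ptypes M i j D.
      by apply/ptypesP; exists 0, 0.
    by rewrite T0 inE.
  apply/existsP/existsP => [[t /andP [/ptypesP [u [v [un vn ->]]] h]]|[u /existsP [v h]]].
    by exists (Ordinal un); apply/existsP; exists (Ordinal vn).
  by exists (pt M i j D u v); rewrite h andbT; apply/ptypesP; exists u, v.
have pair k (G : kgraph k) (r : rel nat) x y : x <= (nv G).-1 -> y <= (nv G).-1 ->
    (0 < nv G -> r x y = [exists u : 'I_(nv G), [exists v : 'I_(nv G), [&& val u == x, val v == y & r u v]]]).
  move=> xn yn G0; have {}xn : x < nv G by lia. have {}yn : y < nv G by lia.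
  apply/idP/existsP => [rxy|[u /existsP [v /and3P [/eqP <- /eqP <-]]]] //.
  by exists (Ordinal xn); apply/existsP; exists (Ordinal yn); rewrite !eqxx.
pose agree (P : pred dgraph) (a : msol) := forall k (G : kgraph k) lb ev eU eB,
  (forall i, ev i <= (nv G).-1) -> sat G ev eU eB a = P (decorate lb ev eU eB).
(* Updating an environment and recolouring the decorated graph lead to graphs related by [deq], on
   which a regular [P] agrees. *)
have updV P a i k (G : kgraph k) lb ev eU eB (v : 'I_(nv G)) : regular P -> agree P a ->
    (forall i, ev i <= (nv G).-1) -> sat G (upd ev i (val v)) eU eB a =
      P (setX (decorate lb ev eU eB) (false, i) (pred1 (val v))).
  move=> rP eP evn; rewrite (eP _ _ lb) => [|i']; last first.
    by rewrite /upd; case: eqP => // _; rewrite /= -ltnS prednK //; apply: leq_ltn_trans (ltn_ord v).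
  apply: (regular_deq rP); split=> //= -[b i'] x _; rewrite /upd xpair_eqE.
  by case: b => //=; case: (i' == i).
have updU P a i k (G : kgraph k) lb ev eU eB (U : {set 'I_(nv G)}) : regular P -> agree P a ->
    (forall i, ev i <= (nv G).-1) -> sat G ev (upd eU i U) eB a =
      P (setX (decorate lb ev eU eB) (true, i) (inset U)).
  move=> rP eP evn; rewrite (eP _ _ lb) //.
  apply: (regular_deq rP); split=> //= -[b i'] x _; rewrite /upd xpair_eqE.
  by case: b => //=; case: (i' == i).
have updB P a i k (G : kgraph k) lb ev eU eB (B : {set 'I_(nv G) * 'I_(nv G)}) :
    regular P -> agree P a ->
    (forall i, ev i <= (nv G).-1) -> sat G ev eU (upd eB i B) a =
      P (setB (decorate lb ev eU eB) i (symrel B)).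
  move=> rP eP evn; rewrite (eP _ _ lb) //.
  by apply: (regular_deq rP); split=> //= i' x y _ _; rewrite /upd; case: (i' == i).
elim: phi => [i j|i j|i j|i j|i j l|a IHa b IHb|a IHa b IHb|a IHa|a IHa b IHb
  |i a IHa|i a IHa|i a IHa|i a IHa|i a IHa|i a IHa] /= md.
- eexists; first exact: (atomic (false, i) (false, j) 0
    (fun t => let: (_, _, (_, eq), _, _, (xi, xj)) := t in [&& xi, xj & eq]) true).
  move=> k G lb ev eU eB evn /=; case: (posnP (nv G)) => [G0|G0] /=.
    by have := evn i; have := evn j; rewrite G0 /= !leqn0 => /eqP -> /eqP ->.
  exact: (pair _ G (fun x y => x == y)).
- eexists; first exact: (atomic (false, i) (false, j) 0
    (fun t => let: (_, _, _, e, _, (xi, xj)) := t in [&& xi, xj & e]) false).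
  move=> k G lb ev eU eB evn /=; case: (posnP (nv G)) => [G0|G0] /=.
    by rewrite /gedge G0; apply/esym/negbTE/existsP => -[[]].
  exact: (pair _ G (gedge G)).
- eexists; first exact: (atomic (false, i) (false, j) 0
    (fun t => let: (_, _, (lt, eq), _, _, (xi, xj)) := t in [&& xi, xj & eq || lt]) true).
  move=> k G lb ev eU eB evn /=; case: (posnP (nv G)) => [G0|G0] /=.
    by have := evn i; have := evn j; rewrite G0 /= !leqn0 => /eqP -> /eqP ->.
  rewrite leq_eqVlt; exact: (pair _ G (fun x y => (x == y) || (x < y))).
- eexists; first exact: (atomic (false, i) (true, j) 0
    (fun t => let: (_, _, (_, eq), _, _, (xi, xj)) := t in [&& xi, xj & eq]) false).
  move=> k G lb ev eU eB evn /=; apply/existsP/existsP => [[v /andP [ei vU]]|[u /existsP [v]]].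
    by exists v; apply/existsP; exists v; rewrite ei insetE vU eqxx.
  by rewrite insetE => /and3P [ei vU /eqP uv]; exists v; rewrite -uv ei vU.
- eexists; first exact: (atomic (false, i) (false, j) l.+1
    (fun t => let: (_, _, _, _, bl, (xi, xj)) := t in [&& xi, xj & bl ord_max]) false).
  move=> k G lb ev eU eB evn /=; case: (posnP (nv G)) => [G0|G0] /=.
    have no0 (u : 'I_(nv G)) : False.
      by have := leq_ltn_trans (leq0n _) (ltn_ord u); rewrite G0.
    by apply/existsP/existsP => [[[u]]|[u]]; case: (no0 u).
  rewrite -/(symrel _ _ _) (pair _ G (symrel (eB l))) //.
  by apply: eq_existsb => u; apply: eq_existsb => v; rewrite ffunE.
- have /andP [mda mdb] : (mode || no_edgeset a) && (mode || no_edgeset b) by rewrite -orb_andr.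
  have [P rP eP] := IHa mda; have [P' rP' eP'] := IHb mdb.
  exists (fun D => P D || P' D); first exact: regular_or.
  by move=> k G lb ev eU eB evn; rewrite (eP _ _ lb) // (eP' _ _ lb).
- have /andP [mda mdb] : (mode || no_edgeset a) && (mode || no_edgeset b) by rewrite -orb_andr.
  have [P rP eP] := IHa mda; have [P' rP' eP'] := IHb mdb.
  exists (fun D => ~~ (~~ P D || ~~ P' D)).
    by apply: regular_not; apply: regular_or; apply: regular_not.
  by move=> k G lb ev eU eB evn; rewrite (eP _ _ lb) // (eP' _ _ lb) // negb_or !negbK.
- have [P rP eP] := IHa md; exists (fun D => ~~ P D); first exact: regular_not.
  by move=> k G lb ev eU eB evn; rewrite (eP _ _ lb).
- have /andP [mda mdb] : (mode || no_edgeset a) && (mode || no_edgeset b) by rewrite -orb_andr.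
  have [P rP eP] := IHa mda; have [P' rP' eP'] := IHb mdb.
  exists (fun D => ~~ P D || P' D).
    by apply: regular_or => //; apply: regular_not.
  by move=> k G lb ev eU eB evn; rewrite (eP _ _ lb) // (eP' _ _ lb) // implybE.
- have [P rP eP] := IHa md.
  exists (fun D => ~~ [exists v : 'I_(dn D), ~~ P (setX D (false, i) (pred1 (val v)))]).
    by apply/regular_not/(@regular_exV (fun D => ~~ P D)); apply: regular_not.
  move=> k G lb ev eU eB evn; rewrite negb_exists; apply: eq_forallb => v.
  by rewrite negbK ; exact: (updV P a i k G lb ev eU eB v rP eP evn).
- have [P rP eP] := IHa md.
  exists (fun D => [exists v : 'I_(dn D), P (setX D (false, i) (pred1 (val v)))]).
    exact: regular_exV.
  move=> k G lb ev eU eB evn; apply: eq_existsb => v.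
  by rewrite /=; exact: (updV P a i k G lb ev eU eB v rP eP evn).
- have [P rP eP] := IHa md.
  exists (fun D => ~~ [exists U : {set 'I_(dn D)}, ~~ P (setX D (true, i) (inset U))]).
    by apply/regular_not/(@regular_exU (fun D => ~~ P D)); apply: regular_not.
  move=> k G lb ev eU eB evn; rewrite negb_exists; apply: eq_forallb => U.
  by rewrite negbK ; exact: (updU P a i k G lb ev eU eB U rP eP evn).
- have [P rP eP] := IHa md.
  exists (fun D => [exists U : {set 'I_(dn D)}, P (setX D (true, i) (inset U))]).
    exact: regular_exU.
  move=> k G lb ev eU eB evn; apply: eq_existsb => U.
  by rewrite /=; exact: (updU P a i k G lb ev eU eB U rP eP evn).
(* [no_edgeset] fails on an edge-set quantifier, so [md] forces [mode], as [regular_exB]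
   requires. *)
- rewrite orbF in md; have [P rP eP] := IHa (introT orP (or_introl md)).
  exists (fun D => ~~ [exists B : {set 'I_(dn D) * 'I_(dn D)},
    (B \subset eset D) && ~~ P (setB D i (symrel B))]).
    by apply: regular_not; apply: (@regular_exB (fun D => ~~ P D) i md); apply: regular_not.
  move=> k G lb ev eU eB evn; rewrite negb_exists; apply: eq_forallb => B.
  by rewrite negb_and negbK implybE; congr (_ || _); exact: (updB P a i k G lb ev eU eB B rP eP evn).
- rewrite orbF in md; have [P rP eP] := IHa (introT orP (or_introl md)).
  exists (fun D => [exists B : {set 'I_(dn D) * 'I_(dn D)},
    (B \subset eset D) && P (setB D i (symrel B))]).
    exact: regular_exB.
  move=> k G lb ev eU eB evn; apply: eq_existsb => B.
  by congr (_ && _); exact: (updB P a i k G lb ev eU eB B rP eP evn).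
Qed.

End Closure.

(** * Transfer matrices *)

Definition fam n T (f : {ffun 'I_n -> {set T}}) (i : nat) : {set T} :=
  if insub i is Some o then f o else set0.

Lemma famE n (T : finType) (f : {ffun 'I_n -> {set T}}) (i : 'I_n) : fam f i = f i.
Proof. by rewrite /fam valK. Qed.

Lemma fam_out n (T : finType) (f : {ffun 'I_n -> {set T}}) i : (i < n) = false -> fam f i = set0.
Proof. by move=> h; rewrite /fam insubF. Qed.

Section Weighted.
Variables (K : fieldType) (Lam : finType) (mode : bool) (k l m : nat).
Variables (A : automaton Lam mode) (xU : 'I_l -> K) (xB : 'I_m -> K).
Local Open Scope ring_scope.

(** Adjoining the pair types makes labels, edges and edge-set memberships visible in the state;
    letters and the validity of annotations are computed from them. *)
Definition full_automaton := prod_automaton A (pt_automaton Lam m (false, 0%N) (false, 0%N) mode).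
Notation Q := (state A * {set ptype Lam m})%type.
Notation st := (run full_automaton).

Definition assignment n : finType := ({ffun 'I_l -> {set 'I_n}} * {ffun 'I_m -> {set 'I_n * 'I_n}})%type.

Definition deco (G : kgraph k) (lb : nat -> Lam) (x : assignment (nv G)) : dgraph Lam :=
  decorate lb (fun=> 0%N) (fam x.1) (fam x.2).

Definition within (G : kgraph k) (x : assignment (nv G)) := [forall j, x.2 j \subset edge_set G].

Definition weight n (x : assignment n) : K :=
  (\prod_i xU i ^+ #|x.1 i|) * \prod_j xB j ^+ #|x.2 j|.

Definition wsum (G : kgraph k) (lb : nat -> Lam) (q : Q) : K :=
  \sum_(x : assignment (nv G) | within x) (st (deco lb x) == q)%:R * weight x.

(** An annotation in [An] records what an assignment of the new graph adds to one of the old graph;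
    [om] is its weight and [sg] gives the letter it induces. *)
Definition wmatrix (An : finType) (valid : Q -> pred An) (sg : Q -> An -> letter Lam)
    (om : An -> K) (q q' : Q) : K :=
  \sum_(a | valid q a) (step (q : state full_automaton) (sg q a) == q')%:R * om a.

(** [h] and [h'] are inverse bijections between assignments of [G'] and pairs of an assignment of
    [G] and a valid annotation. Since weights multiply, reindexing and grouping by the old state
    gives a product with a matrix. *)
Lemma wsum_transfer (G G' : kgraph k) lb lb' (An : finType) (valid : Q -> pred An)
    (sg : Q -> An -> letter Lam) (om : An -> K)
    (h : assignment (nv G) -> An -> assignment (nv G')) (h' : assignment (nv G') -> assignment (nv G) * An) :
    (forall x a, within x -> valid (st (deco lb x)) a ->
      [/\ within (h x a), h' (h x a) = (x, a),
          admissible mode (deco lb x) (sg (st (deco lb x)) a),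
          deq (act (sg (st (deco lb x)) a) (deco lb x)) (deco lb' (h x a))
        & weight (h x a) = weight x * om a]) ->
    (forall x', within x' -> [/\ within (h' x').1, valid (st (deco lb (h' x').1)) (h' x').2
        & h (h' x').1 (h' x').2 = x']) ->
  forall q', wsum G' lb' q' = \sum_q wsum G lb q * wmatrix valid sg om q q'.
Proof.
move=> hP h'P q'; rewrite /wsum.
rewrite (reindex_onto (fun p : assignment (nv G) * An => h p.1 p.2) h'); last first.
  by move=> x' /h'P [].
rewrite (eq_bigl (fun p : assignment (nv G) * An => within p.1 && valid (st (deco lb p.1)) p.2)); last first.
  case=> x a /=; apply/andP/andP => [[wh /eqP e]|[wx va]].
    by have := h'P _ wh; rewrite e => -[].
  by have [wh e _ _ _] := hP x a wx va; rewrite e.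
rewrite -(pair_big_dep (fun x => within x) (fun x a => valid (st (deco lb x)) a)
  (fun x a => (st (deco lb' (h x a)) == q')%:R * weight (h x a))).
under [RHS]eq_bigr do rewrite mulr_suml.
rewrite [RHS]exchange_big; apply: eq_bigr => x wx.
rewrite [RHS](bigD1 (st (deco lb x))) // eqxx mul1r [X in _ = _ + X]big1 ?addr0; last first.
  by move=> q /andP [_ /negbTE nq]; rewrite eq_sym nq !mul0r.
rewrite /wmatrix mulr_sumr; apply: eq_bigr => a va.
have [_ _ adm DD ->] := hP x a wx va.
by rewrite -(run_deq full_automaton DD) (run_act full_automaton adm) mulrCA.
Qed.

Lemma deco_wf (G : kgraph k) lb (x : assignment (nv G)) :
  symmetric (dE (deco lb x)) /\ irreflexive (dE (deco lb x)).
Proof.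
split=> [u v|u] /=; rewrite /gedge; last by rewrite eqxx !andbF.
by rewrite andbCA eq_sym orbC.
Qed.

Lemma edge_set_sub (G : kgraph k) (B : {set 'I_(nv G) * 'I_(nv G)}) u v :
  B \subset edge_set G -> (u, v) \in B -> (u < v)%N && gedge G u v.
Proof. by move=> /subsetP BE /BE; rewrite inE. Qed.

Section Rename.
Variables (f : Q -> Lam -> Lam).

Definition ren_matrix := wmatrix (fun _ (_ : unit) => true) (fun q _ => LRen (f q)) (fun=> 1).

(** The relabelling is read off the state, which keeps the matrix constant, but it is the same map
    [f0] for all assignments of the given graph. *)
Lemma wsum_ren n adj lab lab' lb (f0 : Lam -> Lam) (G := @KGraph k n adj lab) :
    (forall x : assignment (nv G), within x -> f (st (deco lb x)) =1 f0) ->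
  forall q', wsum (@KGraph k n adj lab') (fun x => f0 (lb x)) q' =
    \sum_q wsum G lb q * ren_matrix q q'.
Proof.
move=> ff0; apply: (wsum_transfer (h := fun x _ => x) (h' := fun x => (x, tt))) => [x [] wx _|x' wx'] //.
split=> //; last by rewrite mulr1.
  by have [? ?] := deco_wf lb x; split.
by split=> //= u _; rewrite ff0.
Qed.

End Rename.

Section Delete.
Variables (R : Q -> rel Lam).

(* Edge sets of the new graph are the edge sets of the old one that avoid the
   deleted edges. *)
Definition del_valid (q : Q) (_ : unit) := [forall t in q.2,
  let: (a, b, _, _, bl, _) := t in R q a b ==> [forall j, ~~ bl j]].

Definition del_matrix := wmatrix del_valid (fun q _ => LDel (R q)) (fun=> 1).

Lemma wsum_del n adj adj' lab lab' lb (R0 : rel Lam)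
    (G := @KGraph k n adj lab) (G' := @KGraph k n adj' lab') :
    symmetric R0 -> (forall x : assignment (nv G), within x -> R (st (deco lb x)) =2 R0) ->
    (forall x y, gedge G' x y = gedge G x y && ~~ R0 (lb x) (lb y)) ->
  forall q', wsum G' lb q' = \sum_q wsum G lb q * del_matrix q q'.
Proof.
move=> symR RR0 eG'.
(* The pair types reveal whether some edge set contains a deleted edge, that is, whether the
   assignment fails to fit the smaller graph. *)
have validP (x : assignment n) : @within G x -> del_valid (st (@deco G lb x)) tt = @within G' x.
  move=> wx; apply/forallP/forallP => [h j|h t].
    apply/subsetP => -[u v] uvB; rewrite inE /= eG'.
    have /andP [-> euv] := edge_set_sub (forallP wx j) uvB; rewrite euv /=.
    have tin : pt m (false, 0%N) (false, 0%N) (@deco G lb x) u v \in (st (@deco G lb x)).2.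
      by apply: mem_ptypes; [exact: (ltn_ord u) | exact: (ltn_ord v)].
    have := implyP (h _) tin; rewrite /= RR0 //; apply: contraL => Ruv.
    apply/negP => /implyP /(_ Ruv) /forallP /(_ j); rewrite ffunE famE.
    by rewrite (symrelE (x.2 j) u v) uvB.
  apply/implyP => /= /ptypesP [u [v [un vn ->]]] /=; rewrite RR0 //.
  apply/implyP => Ruv; apply/forallP => j; rewrite ffunE /= famE.
  rewrite -[u]/(val (Ordinal un)) -[v]/(val (Ordinal vn)) symrelE.
  apply/negP => /orP [] /(edge_set_sub (h j)); rewrite eG' /= => /and3P [_ _]; first by rewrite Ruv.
  by rewrite symR Ruv.
apply: (@wsum_transfer G G' lb lb _ del_valid (fun q _ => LDel (R q)) (fun=> 1)
  (fun x _ => x) (fun x => (x, tt))) => [x [] wx vx|x' wx'] //.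
  split=> //; last by rewrite mulr1.
  - by rewrite -validP.
  - by have [? ?] := deco_wf lb x; split=> // a b; rewrite !RR0.
  - split=> //= [u v _ _|j u v un vn]; first by rewrite eG' RR0.
    rewrite RR0 //; have [jm|nj] := boolP (j < m)%N; last first.
      by rewrite fam_out ?(negbTE nj) // [symrel _ _ _](_ : _ = false) //; apply/existsP => -[p]; rewrite inE.
    rewrite validP // in vx; have := forallP vx (Ordinal jm).
    rewrite -[j]/(val (Ordinal jm)) famE => sB.
    rewrite -[u]/(val (Ordinal un)) -[v]/(val (Ordinal vn)) symrelE.
    case: orP => //= -[] /(edge_set_sub sB); rewrite eG' /= => /and3P [_ _ nR].
      by rewrite nR.
    by rewrite symR nR.
have wx : @within G x'.
  apply/forallP => j; apply/subsetP => p /(subsetP (forallP wx' j)).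
  by rewrite !inE eG' => /and3P [-> ->].
by split=> //=; rewrite validP.
Qed.

End Delete.

Section Join.
Variables (R : Q -> rel Lam).

(* The annotation [C] lists, for each edge-set variable, the label pairs (smaller
   vertex first) of the new edges it contains. *)
Definition eta_valid (q : Q) (C : {ffun 'I_m -> {set Lam * Lam}}) :=
  [forall j, C j \subset [set p : Lam * Lam | R q p.1 p.2 && [exists t in q.2,
     let: (a, b, (lt, _), e, _, _) := t in [&& p == (a, b), lt & ~~ e]]]].

Definition eta_letter (q : Q) (C : {ffun 'I_m -> {set Lam * Lam}}) :=
  LEta (R q) (fun i a b => ((a, b) \in fam C i) || ((b, a) \in fam C i)).

Definition eta_matrix := wmatrix eta_valid eta_letter (fun C => \prod_j xB j ^+ #|C j|).

(** By thinness distinct new edges have distinct label pairs, so a valid annotation amounts to a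
    choice of new edges for each edge set, with the same cardinalities. With [m = 0] and [mode]
    false there is nothing to choose, and the join is arbitrary. *)
Lemma wsum_eta n adj adj' lab lab' lb (R0 : rel Lam)
    (G := @KGraph k n adj lab) (G' := @KGraph k n adj' lab') :
    symmetric R0 -> (forall x : assignment (nv G), within x -> R (st (deco lb x)) =2 R0) ->
    ((0 < m)%N || mode -> forall x y t, (x < n)%N -> (y < n)%N ->
       R0 (lb x) t -> lb x = lb y -> x = y) ->
    (forall x y, gedge G' x y =
       gedge G x y || [&& (x < n)%N, (y < n)%N, x != y & R0 (lb x) (lb y)]) ->
  forall q', wsum G' lb q' = \sum_q wsum G lb q * eta_matrix q q'.
Proof.
move=> symR RR0 thinR eG'.
pose newp (p : 'I_n * 'I_n) :=
  [&& (p.1 < p.2)%N, ~~ gedge G p.1 p.2 & R0 (lb p.1) (lb p.2)].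
pose lbp (p : 'I_n * 'I_n) := (lb p.1, lb p.2).
have newE p : (p \in edge_set G') = (p \in edge_set G) || newp p.
  rewrite !inE eG' /newp !ltn_ord /=; case: ltnP => //= lt.
  by rewrite (ltn_eqF lt) /=; case: gedge.
have new_old p : newp p -> p \in edge_set G = false.
  by case/and3P => _ /negbTE ne _; rewrite inE ne andbF.
have lbp_inj (j : 'I_m) p p' : newp p -> newp p' -> lbp p = lbp p' -> p = p'.
  case: p p' => [u v] [u' v'] /and3P [/= _ _ Ruv] _ [e1 e2].
  have m0 : (0 < m)%N || mode by rewrite (leq_ltn_trans _ (ltn_ord j)).
  congr (_, _); apply: val_inj; apply: (thinR m0 _ _ _ (ltn_ord _) (ltn_ord _)) => //=.
    exact: Ruv.
  by rewrite symR; apply: Ruv.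
(* The new edges selected by an annotation; [lbpN] recovers the annotation from them. *)
pose N (C : {set Lam * Lam}) := [set p | newp p && (lbp p \in C)].
have lbpN (x : assignment n) C j : @within G x -> eta_valid (st (@deco G lb x)) C -> lbp @: N (C j) = C j.
  move=> wx vC; apply/setP => -[a b]; apply/imsetP/idP => [[p]|abC].
    by rewrite inE => /andP [_ h] ->.
  have := subsetP (forallP vC j) _ abC; rewrite inE RR0 //= => /andP [Rab /existsP [t]].
  case/andP => /ptypesP [u [v [un vn ->]]] /= /and3P [/eqP [ea eb] lt nuv].
  exists (Ordinal un, Ordinal vn); last by rewrite ea eb.
  by rewrite inE /newp /lbp /= lt nuv -ea -eb Rab abC.
apply: (@wsum_transfer G G' lb lb _ eta_valid eta_letter _
  (fun x C => (x.1, [ffun j => x.2 j :|: N (C j)]))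
  (fun x => ((x.1, [ffun j => x.2 j :&: edge_set G]), [ffun j => lbp @: (x.2 j :\: edge_set G)]))).
  move=> x C wx vC; split.
  - apply/forallP => j; rewrite ffunE; apply/subsetP => p; rewrite newE inE.
    case/orP => [/(subsetP (forallP wx j)) -> //|]; rewrite inE => /andP [-> _].
    by rewrite orbT.
  - case: x wx vC => [U B] wx vC /=; congr (_, _, _).
      apply/ffunP => j; rewrite !ffunE; apply/setP => p; rewrite !inE.
      have := subsetP (forallP wx j) p; have := new_old p; rewrite inE.
      case: (p \in B j) => /= nE; first by move=> /(_ isT).
      by move=> _; case: (newp p) nE => // /(_ isT) ->; rewrite andbF.
    apply/ffunP => j; rewrite !ffunE -[RHS](lbpN _ _ j wx vC).
    suff -> : (B j :|: N (C j)) :\: edge_set G = N (C j) by [].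
    apply/setP => p; rewrite in_setD in_setU.
    have [pE|npE] /= := boolP (p \in edge_set G).
      by rewrite inE; case np: (newp p) => //; rewrite (new_old p np) in pE.
    by case pB: (p \in B j) => //; rewrite (subsetP (forallP wx j) p pB) in npE.
  - have [? ?] := deco_wf lb x; split=> //; split=> [a b|md a b t an bn]; rewrite !RR0 //.
    by apply: thinR => //; rewrite md orbT.
  - split=> //= [u v un vn|i u v un vn]; rewrite RR0 // ?eG' ?un ?vn //.
    have [im|ni] := boolP (i < m)%N; last first.
      rewrite !fam_out ?(negbTE ni) // !inE !andbF orbF.
      by apply/existsP/existsP => -[p]; rewrite inE.
    rewrite -[i]/(val (Ordinal im)) !famE ffunE; set j := Ordinal im.
    rewrite -[u]/(val (Ordinal un)) -[v]/(val (Ordinal vn)).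
    rewrite !symrelE !inE /newp /lbp /=.
    have m0 : (0 < m)%N || mode by rewrite (leq_ltn_trans _ im).
    (* A listed label pair has its smaller vertex first, so at most one orientation of a new edge is
       listed. *)
    have lt_of a b (an : (a < n)%N) (bn : (b < n)%N) :
        (lb a, lb b) \in C j -> R0 (lb a) (lb b) -> (a < b)%N.
      move=> abC Rab; have := subsetP (forallP vC j) _ abC.
      rewrite inE => /andP [_ /existsP [t /andP [/ptypesP [a' [b' [a'n b'n ->]]]]]] /=.
      case/and3P => /eqP [ea eb] lt _.
      rewrite (thinR m0 _ _ _ an a'n Rab ea).
      by rewrite symR in Rab; rewrite (thinR m0 _ _ _ bn b'n Rab eb).
    have symG : gedge G v u = gedge G u v by have [symE _] := deco_wf lb x; apply: symE.
    rewrite symG (symR (lb v)).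
    have := lt_of u v un vn; have := lt_of v u vn un; rewrite (symR (lb v)).
    case: (R0 _ _); last by rewrite !andbF !orbF.
    case: (gedge G u v); first by rewrite !andbF !orbF.
    case: ((lb u, lb v) \in C j); case: ((lb v, lb u) \in C j); rewrite ?andbF ?andbT ?orbF //=.
    + by move=> /(_ isT isT) h1 /(_ isT isT) h2; have := ltn_trans h1 h2; rewrite ltnn.
    + by move=> _ /(_ isT isT) lt; rewrite lt (ltn_eqF lt) !orbT.
    + by move=> /(_ isT isT) lt _; rewrite lt (gtn_eqF lt) !orbT.
  - rewrite /weight /= -mulrA -big_split /=; congr (_ * _); apply: eq_bigr => j _.
    have cN : #|C j| = #|N (C j)|.
      rewrite -{1}(lbpN _ _ j wx vC) card_in_imset // => p p'.
      by rewrite !inE => /andP [np _] /andP [np' _]; apply: (lbp_inj j).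
    rewrite ffunE -exprD cardsU cN.
    suff -> : x.2 j :&: N (C j) = set0 by rewrite cards0 subn0.
    apply/setP => p; rewrite !inE; apply/negP => /andP [/(subsetP (forallP wx j)) pE].
    by case/andP => /new_old; rewrite pE.
move=> x' wx'.
have wx : @within G (x'.1, [ffun j => x'.2 j :&: edge_set G]).
  by apply/forallP => j; rewrite ffunE subsetIr.
have newB j p : p \in x'.2 j -> p \notin edge_set G -> newp p.
  by move=> /(subsetP (forallP wx' j)); rewrite newE => /orP [->|].
split=> //.
  apply/forallP => j; rewrite ffunE; apply/subsetP => _ /imsetP [p + ->].
  rewrite inE => /andP [npE pB]; have np := newB j p pB npE.
  have /and3P [lt nuv Ruv] := np.
  rewrite inE RR0 //= Ruv /=; apply/existsP.
  exists (pt m (false, 0%N) (false, 0%N) (@deco G lb (x'.1, [ffun j => x'.2 j :&: edge_set G])) p.1 p.2).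
  by rewrite mem_ptypes ?ltn_ord //= eqxx lt nuv.
case: x' wx' newB {wx} => [U B] wx' newB /=; congr (_, _).
apply/ffunP => j; rewrite !ffunE; apply/setP => p; rewrite [LHS]inE [in LHS]inE.
have [pE|npE] /= := boolP (p \in edge_set G).
  rewrite andbT; case: (p \in B j) => //=; rewrite inE.
  by apply/negP => /andP [/new_old]; rewrite pE.
rewrite andbF /= inE; apply/andP/idP => [[np /imsetP [p']]|pB].
  by rewrite inE => /andP [npE' pB'] e; rewrite (lbp_inj j _ _ np (newB j _ pB' npE') e).
split; first exact: newB pB npE.
by apply: imset_f; rewrite inE npE.
Qed.

End Join.

Section AddVertex.
Variables (f : Q -> Lam -> Lam) (lam : Q -> Lam).

Definition famb (c : {ffun 'I_l -> bool}) (i : nat) : bool :=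
  if insub i is Some o then c o else false.

(* The free vertex variables denote vertex 0, hence the test for the empty graph. *)
Definition add_letter (q : Q) (c : {ffun 'I_l -> bool}) :=
  LAdd (f q) (lam q) (fun i => if i.1 then famb c i.2 else q.2 == set0).

Definition add_matrix :=
  wmatrix (fun _ _ => true) add_letter (fun c => \prod_i xU i ^+ c i).

Lemma wsum_add n adj adj' lab lab' lb (f0 : Lam -> Lam) (lam0 : Lam)
    (G := @KGraph k n adj lab) (G' := @KGraph k n.+1 adj' lab') :
    (forall x : assignment (nv G), within x ->
       f (st (deco lb x)) =1 f0 /\ lam (st (deco lb x)) = lam0) ->
    (forall x y, gedge G' x y = gedge G x y) ->
  forall q', wsum G' (fun x => if x == n then lam0 else f0 (lb x)) q' =
    \sum_q wsum G lb q * add_matrix q q'.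
Proof.
move=> ff0 eG'.
(* [w] embeds the old vertices below the new vertex [ord_max] without changing their numbers. *)
have [w [w_inj wE w_max wP]] : exists w : 'I_n -> 'I_n.+1, [/\ injective w,
    forall u, w u = u :> nat, forall u, w u == ord_max = false
    & forall v, v = ord_max \/ exists u, v = w u].
  exists (lift ord_max); split=> [|u|u|v]; first exact: lift_inj.
  - exact: lift_max.
  - by rewrite eq_sym; apply/negbTE/neq_lift.
  - by case: (unliftP ord_max v) => [u|] ->; [right; exists u | left].
pose ww (p : 'I_n * 'I_n) := (w p.1, w p.2).
have ww_inj : injective ww.
  move=> [a b] [a' b'] e; congr (_, _); apply: w_inj.
    exact: (congr1 fst e).
  exact: (congr1 snd e).
have edgeP p : p \in edge_set G' -> exists2 p', p = ww p' & p' \in edge_set G.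
  case: p => u v; rewrite inE /= eG' => /andP [lt e]; have /and3P [un vn _] := e.
  exists (Ordinal un, Ordinal vn); last by rewrite inE lt.
  by congr (_, _); apply: val_inj; rewrite /= wE.
have ww_edge p : (ww p \in edge_set G') = (p \in edge_set G).
  by rewrite !inE eG' /= !wE.
pose up (U : {set 'I_n}) (b : bool) := w @: U :|: (if b then [set ord_max] else set0).
have upw U b u : (w u \in up U b) = (u \in U).
  by rewrite inE mem_imset //; case: b; rewrite !inE ?w_max ?orbF.
have up_max U b : (ord_max \in up U b) = b.
  rewrite inE; have /negbTE -> : ord_max \notin w @: U.
    by apply/imsetP => -[u _ e]; have := w_max u; rewrite -e eqxx.
  by case: b; rewrite !inE ?eqxx.
have card_up U b : #|up U b| = (#|U| + b)%N.
  rewrite cardsU card_imset //; have -> : w @: U :&: (if b then [set ord_max] else set0) = set0.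
    apply/setP => v; rewrite !inE; apply/negP => /andP [/imsetP [u _ ->]].
    by case: b; rewrite inE ?w_max.
  by rewrite cards0 subn0; case: b; rewrite ?cards1 ?cards0.
apply: (@wsum_transfer G G' lb _ _ (fun _ _ => true) add_letter _
  (fun x c => ([ffun i => up (x.1 i) (c i)], [ffun j => ww @: x.2 j]))
  (fun x => (([ffun i => w @^-1: x.1 i], [ffun j => ww @^-1: x.2 j]), [ffun i => ord_max \in x.1 i]))).
  move=> x c wx _; split.
  - apply/forallP => j; rewrite ffunE; apply/subsetP => _ /imsetP [p pB ->].
    by rewrite ww_edge (subsetP (forallP wx j)).
  - case: x wx => [U B] wx /=; congr (_, _, _); apply/ffunP => j; rewrite !ffunE.
    + by apply/setP => u; rewrite inE upw.
    + by apply/setP => p; rewrite inE mem_imset.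
    + by rewrite up_max.
  - by have [? ?] := deco_wf lb x; split.
  - have [ff ll] := ff0 x wx; split=> //.
    + by move=> u _ /=; rewrite ll; case: eqP => // _; rewrite ff.
    + move=> u v _ _ /=; rewrite eG'; case e: (gedge G u v) => //=.
      by have /and3P [-> -> _] := e.
    + case=> [[] i] y yn /=; last first.
        case: eqP => // ->; apply/eqP/eqP => [T0|n0]; last first.
          apply/setP => t; rewrite inE; apply/ptypesP => -[u [v [un _ _]]].
          by rewrite /= n0 in un.
        case: (posnP n) => // n0.
        have := @mem_ptypes Lam m (false, 0%N) (false, 0%N) (deco lb x) 0 0 n0 n0.
        by rewrite T0 inE.
      have [im|ni] := boolP (i < l)%N; last first.
        rewrite !fam_out ?(negbTE ni) // /famb insubF ?(negbTE ni) //.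
        rewrite [inset set0 y](_ : _ = false); last by apply/existsP => -[v]; rewrite inE andbF.
        rewrite [inset set0 y](_ : _ = false); last by apply/existsP => -[v]; rewrite inE andbF.
        by case: eqP.
      rewrite -[i]/(val (Ordinal im)) !famE /famb valK ffunE.
      case: eqP => [->|/eqP ny].
        by rewrite -[n in RHS]/(val (@ord_max n)) insetE up_max.
      have yn' : (y < n)%N by rewrite /= in yn; lia.
      rewrite [RHS](_ : _ = (w (Ordinal yn') \in up (x.1 (Ordinal im)) (c (Ordinal im)))); last first.
        by rewrite -insetE wE.
      by rewrite upw -insetE.
    + move=> i u v un vn /=.
      have [im|ni] := boolP (i < m)%N; last first.
        rewrite !fam_out ?(negbTE ni) //.
        rewrite [symrel set0 u v](_ : _ = false); last by apply/existsP => -[p]; rewrite inE.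
        by apply/esym/existsP => -[p]; rewrite inE.
      rewrite -[i]/(val (Ordinal im)) !famE ffunE; set B := x.2 _.
      have [/andP [un' vn']|out] := boolP ((u < n)%N && (v < n)%N).
        rewrite andbT (_ : symrel (ww @: B) u v =
          symrel (ww @: B) (w (Ordinal un')) (w (Ordinal vn'))); last by rewrite /= !wE.
        rewrite -{1}[u]/(val (Ordinal un')) -{1}[v]/(val (Ordinal vn')) !symrelE.
        by rewrite -![(w _, w _)]/(ww (_, _)) !mem_imset.
      rewrite andbF; apply/esym/existsP => -[_ /andP [/imsetP [[a b] _ ->]]] /=.
      have an := ltn_ord a; have bn := ltn_ord b; rewrite !wE.
      by case/orP => /andP [/eqP e1 /eqP e2]; move: out; rewrite -e1 -e2 an bn.
  - rewrite /weight /= mulrAC -big_split /=; congr (_ * _); apply: eq_bigr => i _.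
      by rewrite ffunE card_up exprD.
    by rewrite ffunE card_imset.
case=> U B wx' /=; split=> //.
  apply/forallP => j; rewrite ffunE; apply/subsetP => p; rewrite inE.
  by move=> /(subsetP (forallP wx' j)); rewrite ww_edge.
congr (_, _); apply/ffunP => j; rewrite !ffunE; apply/setP => v.
  by case: (wP v) => [->|[u ->]]; [rewrite up_max | rewrite upw inE].
apply/imsetP/idP => [[p]|vB]; first by rewrite inE => ? ->.
have [p e _] := edgeP v (subsetP (forallP wx' j) v vB).
by exists p; rewrite // inE -e.
Qed.

End AddVertex.

End Weighted.

(** * Singling out the vertices of small label classes *)

Lemma iota_split x n : x < n -> iota 0 n = iota 0 x ++ x :: iota x.+1 (n - x.+1).
Proof.
move=> xn; have {1}-> : n = x + (n - x.+1).+1 by lia.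
by rewrite iotaD /= add0n.
Qed.

Section Labelling.
Variables (k b : nat).
Notation Lam := ('I_k * 'I_b.+1)%type.

Lemma lam_ext (p q : Lam) : p.1 = q.1 -> p.2 = q.2 -> p = q.
Proof. by case: p q => [a c] [a' c'] /= -> ->. Qed.

Definition cls (G : kgraph k) (i : 'I_k) := count (fun x => lab G x == i) (iota 0 (nv G)).

(* A class [i] of size [c <= b] uses the distinct labels [(i, r)] with [r < c]; all
   vertices of a larger class have the label [(i, b)]. *)
Definition labelling (G : kgraph k) (lb : nat -> Lam) :=
  [/\ forall x, x < nv G -> (lb x).1 = lab G x,
      forall x, x < nv G -> cls G (lab G x) <= b -> (lb x).2 < cls G (lab G x),
      forall x, x < nv G -> b < cls G (lab G x) -> (lb x).2 = ord_max
    & forall x y, x < nv G -> y < nv G -> cls G (lab G x) <= b -> lb x = lb y -> x = y].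

Lemma cls_card G i : cls G i = #|[set u : 'I_(nv G) | lab G u == i]|.
Proof.
rewrite /cls -val_enum_ord count_map cardE -size_filter enumT; congr size.
by apply: eq_filter => u; rewrite /= inE.
Qed.

(** In a small class the index of a vertex is its rank, the number of earlier vertices of the same
    class. *)
Lemma labelling_exists (G : kgraph k) : exists lb, labelling G lb.
Proof.
pose rk x := count (fun y => lab G y == lab G x) (iota 0 x).
have rk_lt x y : x < y -> lab G x = lab G y -> rk x < rk y.
  by move=> xy e; rewrite /rk (iota_split xy) count_cat /= -e eqxx; lia.
have rk_cls x : x < nv G -> rk x < cls G (lab G x).
  by move=> xn; rewrite /rk /cls (iota_split xn) count_cat /= eqxx; lia.
exists (fun x => (lab G x, if cls G (lab G x) <= b then inord (rk x) else ord_max)); split=> //=.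
- move=> x xn h; rewrite h inordK; first exact: rk_cls.
  by rewrite ltnS; apply: leq_trans h; apply/ltnW/rk_cls.
- by move=> x xn; rewrite ltnNge => /negbTE ->.
move=> x y xn yn h [e]; rewrite -e h => /(congr1 val) /=.
rewrite !inordK; last 2 first.
- by rewrite ltnS; apply: leq_trans h; rewrite e; apply/ltnW/rk_cls.
- by rewrite ltnS; apply: leq_trans h; apply/ltnW/rk_cls.
move=> erk; case: (ltngtP x y) => // xy.
  by have := rk_lt x y xy e; rewrite erk ltnn.
by have := rk_lt y x xy (esym e); rewrite erk ltnn.
Qed.

Section Counts.
Variable M : nat.

Definition used (T : {set ptype Lam M}) (a : Lam) :=
  [exists t in T, let: (a', _, _, _, _, _) := t in a' == a].

(* Reads off the size of class [i], truncated at [b.+1], from a state. *)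
Definition cq (T : {set ptype Lam M}) (i : 'I_k) : nat :=
  if used T (i, ord_max) then b.+1 else #|[set r : 'I_b.+1 | used T (i, r)]|.

(** A class of size at most [b] uses one label per vertex, with indices below its size and hence
    never [ord_max]; a larger class does use [ord_max]. So the labels in use determine the truncated
    size. *)
Lemma cqE (G : kgraph k) lb D i0 j0 i : labelling G lb -> dn D = nv G -> dl D =1 lb ->
  cq (ptypes M i0 j0 D) i = minn (cls G i) b.+1.
Proof.
move=> [lb1 lb2 lb3 lb4] en el; set T := ptypes _ _ _ _.
have usedP a : reflect (exists2 x, x < nv G & lb x = a) (used T a).
  apply: (iffP existsP) => [[t /andP [/ptypesP [u [v [un vn ->]]] /= /eqP <-]]|[x xn <-]].
    by exists u; rewrite -?en ?el.
  by rewrite -en in xn; exists (pt M i0 j0 D x x); rewrite mem_ptypes //= el.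
rewrite /cq; case: (leqP (cls G i) b) => h.
  have -> : used T (i, ord_max) = false.
    apply/usedP => -[x xn e]; have := lb2 x xn; have := lb1 x xn; rewrite e /= => <- /(_ h).
    by move=> h'; have := leq_trans h' h; rewrite ltnn.
  rewrite (minn_idPl (leqW h)) cls_card.
  rewrite -(card_in_imset (f := fun u : 'I_(nv G) => (lb u).2)); last first.
    move=> u v; rewrite !inE => /eqP lu /eqP lv e; apply: val_inj.
    apply: lb4; rewrite ?lu //; try exact: ltn_ord.
    by apply: lam_ext => //; rewrite !lb1 ?ltn_ord ?lu ?lv.
  apply: eq_card => r; rewrite inE; apply/usedP/imsetP => [[x xn e]|[u]].
    by exists (Ordinal xn); rewrite ?inE /= -?lb1 // e.
  rewrite inE => /eqP lu ->; exists u; first exact: ltn_ord.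
  by apply: lam_ext; rewrite //= lb1 ?ltn_ord // lu.
rewrite (minn_idPr h) ifT //.
have : 0 < cls G i by apply: leq_ltn_trans h.
rewrite cls_card => /card_gt0P [u]; rewrite inE => /eqP lu.
apply/usedP; exists u; first exact: ltn_ord.
by apply: lam_ext; [rewrite lb1 ?ltn_ord | apply: lb3; rewrite ?ltn_ord // lu].
Qed.

End Counts.

(** If class [i] already has [b] vertices, the addition makes it large and all its labels
    collapse. *)
Definition add_relabel (i : 'I_k) (c : nat) (a : Lam) : Lam :=
  if (a.1 == i) && (b <= c) then (a.1, ord_max) else a.

(** Index [c] is the first free one; for [c] at least [b] the index is [b], that is [ord_max]. *)
Definition add_label (i : 'I_k) (c : nat) : Lam := (i, inord (minn c b)).

Lemma labelling_add G lb i (c := minn (cls G i) b.+1) : labelling G lb ->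
  labelling (apply_basic (OAdd i) G)
    (fun x => if x == nv G then add_label i c else add_relabel i c (lb x)).
Proof.
move=> [lb1 lb2 lb3 lb4].
have clsE a : cls (apply_basic (OAdd i) G) a = cls G a + (a == i).
  rewrite /cls -[nv (apply_basic _ _)]/(nv G).+1 -addn1 iotaD count_cat /= eqxx addn0 [i == a]eq_sym.
  congr (_ + _).
  by apply: eq_in_count => x; rewrite mem_iota /= add0n => xn; rewrite (ltn_eqF xn).
have old x : x < (nv G).+1 -> (x == nv G) = false -> x < nv G by move=> ? /negbT; lia.
have c_le : (b <= c) = (b <= cls G i) by rewrite /c; lia.
split=> [x|x|x|x y]; rewrite ?clsE /=.
- case: eqP => // /eqP /negbTE nx xn; rewrite /add_relabel.
  by case: ifP => _ /=; rewrite lb1 // old.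
- case: ifP => [_ _|nx xn]; first by rewrite eqxx => h; rewrite /= inordK; lia.
  have {}xn := old x xn nx; rewrite /add_relabel lb1 // c_le.
  case: eqP => [e|_] /= h.
    by rewrite e in h *; rewrite ifF; [have := lb2 x xn; rewrite e; lia | lia].
  by have := lb2 x xn; lia.
- case: ifP => [_ _|nx xn]; first by rewrite eqxx => h; apply: val_inj; rewrite /= inordK; lia.
  have {}xn := old x xn nx; rewrite /add_relabel lb1 // c_le.
  case: eqP => [e|_] /= h; first by rewrite e in h; rewrite ifT //; lia.
  by apply: lb3 => //; lia.
have new z : z < nv G -> cls G i + 1 <= b -> add_label i c = add_relabel i c (lb z) -> False.
  move=> zn h; rewrite /add_relabel c_le; case: ifP => [|_]; first by lia.
  move=> e; have := lb2 z zn; rewrite -lb1 // -e /= inordK; lia.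
case: ifP => [/eqP ex|nx]; case: ifP => [/eqP ey|ny] xn yn; rewrite ?eqxx.
- by rewrite ex ey.
- by move=> h e; case: (new y _ h e); apply: old.
- move=> h e; case: (new x) => //; first exact: old.
  have := congr1 fst e; rewrite /add_relabel /=; case: ifP => _ /=; rewrite lb1 ?old // => e';
    by move: h; rewrite e' eqxx.
have {}xn := old x xn nx; have {}yn := old y yn ny => h.
rewrite /add_relabel c_le !lb1 //.
case: eqP h => [ex|nex] /= h.
  rewrite ex in h; have bi : b <= cls G i = false by lia.
  by rewrite bi andbF => e; apply: lb4 => //; rewrite ex; lia.
case: ifP => _ e; last by apply: lb4 => //; lia.
have hx : cls G (lab G x) <= b by lia.
by have := leq_trans (lb2 x xn hx) hx; rewrite e /= ltnn.
Qed.

(** If the merged class stays small, class [j] keeps its indices, all below [cj], and those of class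
    [i] are shifted past them; otherwise all labels collapse. For [i = j] nothing moves. *)
Definition ren_relabel (i j : 'I_k) (ci cj : nat) (a : Lam) : Lam :=
  if (i == j) || ((a.1 != i) && (a.1 != j)) then a
  else if ci + cj <= b then (j, if a.1 == i then inord (a.2 + cj) else a.2)
  else (j, ord_max).

Lemma labelling_ren G lb i j (ci := minn (cls G i) b.+1) (cj := minn (cls G j) b.+1) :
  labelling G lb ->
  labelling (apply_basic (ORen i j) G) (fun x => ren_relabel i j ci cj (lb x)).
Proof.
move=> [lb1 lb2 lb3 lb4].
have [eij|nij] := eqVneq i j.
  have labE x : (if lab G x == i then j else lab G x) = lab G x by case: eqP => // ->.
  have clsE a : cls (apply_basic (ORen i j) G) a = cls G a.
    by rewrite /cls; apply: eq_count => x /=; rewrite labE.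
  by split=> [x|x|x|x y]; rewrite /ren_relabel ?clsE /= !labE !eij eqxx /=; auto; apply: lb4.
have cls_other a : a != i -> a != j -> cls (apply_basic (ORen i j) G) a = cls G a.
  move=> ai aj; apply: eq_count => x /=; have [->|//] := eqVneq (lab G x) i.
  by rewrite [j == a]eq_sym [i == a]eq_sym (negbTE ai) (negbTE aj).
have cls_j : cls (apply_basic (ORen i j) G) j = cls G i + cls G j.
  rewrite /cls -count_predUI -[LHS]addn0; congr (_ + _).
    by apply: eq_count => x /=; have [_|//] := eqVneq (lab G x) i; rewrite eqxx.
  rewrite (eq_count (a2 := pred0)) ?count_pred0 // => x /=.
  by have [->|//] := eqVneq (lab G x) i; rewrite (negbTE nij).
have c_le : (ci + cj <= b) = (cls G i + cls G j <= b) by rewrite /ci /cj; lia.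
have lab_new x : x < nv G -> lab G x != i -> lab G x != j ->
    ren_relabel i j ci cj (lb x) = lb x.
  by move=> xn xi xj; rewrite /ren_relabel lb1 // xi xj orbT.
have lab_ij x : x < nv G -> (lab G x == i) || (lab G x == j) ->
   ren_relabel i j ci cj (lb x) = if cls G i + cls G j <= b
     then (j, if lab G x == i then inord ((lb x).2 + cj) else (lb x).2) else (j, ord_max).
  by move=> xn xij; rewrite /ren_relabel lb1 // (negbTE nij) -negb_or xij /= c_le.
have lab'E x : (lab (apply_basic (ORen i j) G) x) =
    if (lab G x == i) || (lab G x == j) then j else lab G x.
  by rewrite /=; case: eqP => //= _; case: eqP => [->|].
have small x : x < nv G -> (lab G x == i) || (lab G x == j) -> cls G i + cls G j <= b ->
   ((ren_relabel i j ci cj (lb x)).2 = (if lab G x == i then (lb x).2 + cls G j else (lb x).2) :> nat)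
   /\ (lb x).2 < (if lab G x == i then cls G i else cls G j).
  move=> xn xij h; rewrite lab_ij // h /=; case: eqP xij => [xi _|_ /= /eqP xj].
    have lt : (lb x).2 < cls G i by rewrite -xi; apply: lb2; rewrite ?xi //; lia.
    by rewrite inordK /cj; lia.
  by rewrite -xj; split=> //; apply: lb2; rewrite ?xj //; lia.
split=> [x xn|x xn|x xn|x y xn yn].
- rewrite lab'E; case: ifP => [xij|/negbT]; first by rewrite lab_ij //; case: ifP.
  by rewrite negb_or => /andP [xi xj]; rewrite lab_new ?lb1.
- rewrite lab'E; case: ifP => [xij|/negbT].
    rewrite cls_j => h; have [-> lt] := small x xn xij h; case: ifP lt => _; lia.
  by rewrite negb_or => /andP [xi xj]; rewrite lab_new ?cls_other //; apply: lb2.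
- rewrite lab'E; case: ifP => [xij|/negbT].
    by rewrite cls_j => h; rewrite lab_ij // leqNgt h.
  by rewrite negb_or => /andP [xi xj]; rewrite lab_new ?cls_other //; apply: lb3.
rewrite lab'E; case: ifP => [xij|/negbT].
  rewrite cls_j => h; have [yij|] := boolP ((lab G y == i) || (lab G y == j)); last first.
    rewrite negb_or => /andP [yi yj]; rewrite lab_ij // h (lab_new y) // => /(congr1 fst) /=.
    by rewrite lb1 // => e; rewrite -e eqxx in yj.
  move=> e; have := congr1 (fun a : Lam => a.2 : nat) e.
  have [-> lx] := small x xn xij h; have [-> ly] := small y yn yij h.
  (* Equal indices force both vertices into the same old class: indices coming from [i] are at least
     [cls G j], those coming from [j] are smaller. *)
  case: (eqVneq (lab G x) i) xij lx => [xi _|xi /= /eqP xj] lx;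
    case: (eqVneq (lab G y) i) yij ly => [yi _|yi /= /eqP yj] ly e2; try by lia.
  + apply: lb4; rewrite // ?xi; first by lia.
    by apply: lam_ext; [rewrite !lb1 // xi yi | apply: val_inj => /=; lia].
  + apply: lb4; rewrite // ?xj; first by lia.
    by apply: lam_ext; [rewrite !lb1 // xj yj | apply: val_inj => /=; lia].
rewrite negb_or => /andP [xi xj]; rewrite cls_other // lab_new // => h.
have [yij|] := boolP ((lab G y == i) || (lab G y == j)).
  rewrite lab_ij // => e; have : (lb x).1 = j by rewrite e; case: ifP.
  by rewrite lb1 // => e'; rewrite e' eqxx in xj.
by rewrite negb_or => /andP [yi yj]; rewrite (lab_new y) //; apply: lb4.
Qed.

End Labelling.

(** * Simulation of the operations on k-graphs by constant matrices *)

Section Operations.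
Variables (K : fieldType) (k b l m : nat) (mode : bool).
Notation Lam := ('I_k * 'I_b.+1)%type.
Variables (A : automaton Lam mode) (xU : 'I_l -> K) (xB : 'I_m -> K).
Notation Q := (state A * {set ptype Lam m})%type.
Notation st := (run (full_automaton m A)).
Notation wsum := (@wsum K Lam mode k l m A xU xB).
Local Open Scope ring_scope.

Definition fits (o : basic_op k) : bool :=
  match o with
  | OEta _ _ => (m == 0%N) && ~~ mode
  | OEtaB b' _ _ => (b' <= b)%N
  | _ => true
  end.

Definition lrel (i j : 'I_k) : rel Lam := fun a c =>
  ((a.1 == i) && (c.1 == j)) || ((a.1 == j) && (c.1 == i)).

(** For [i = j] the union is a single class. The sizes supplied are truncated at [b.+1], which is
    harmless when [b' <= b]. *)
Definition active b' (i j : 'I_k) (n : 'I_k -> nat) : bool :=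
  ((if i == j then n i else n i + n j) <= b')%N.

Definition basic_matrix (o : basic_op k) : Q -> Q -> K :=
  match o with
  | OAdd i => add_matrix xU (fun q : Q => add_relabel i (cq q.2 i))
                (fun q : Q => add_label b i (cq q.2 i))
  | ORen i j => ren_matrix K (fun q : Q => ren_relabel i j (cq q.2 i) (cq q.2 j))
  | OEta i j => eta_matrix xB (fun _ : Q => lrel i j)
  | OEtaB b' i j => eta_matrix xB (fun (q : Q) a c => active b' i j (cq q.2) && lrel i j a c)
  | ODel i j => del_matrix K (fun _ : Q => lrel i j)
  end.

Lemma lrel_sym i j : symmetric (lrel i j).
Proof. by move=> a c; rewrite /lrel orbC ![(c.1 == _) && _]andbC. Qed.

Lemma lrel_between (G : kgraph k) (lb : nat -> Lam) i j x y : labelling G lb ->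
  (x < nv G)%N -> (y < nv G)%N -> between G i j x y = lrel i j (lb x) (lb y).
Proof. by move=> [lb1 _ _ _] xn yn; rewrite /between /lrel !lb1. Qed.

Lemma between_sym (G : kgraph k) i j x y : between G i j x y = between G i j y x.
Proof. by rewrite /between orbC ![(lab G y == _) && _]andbC. Qed.

Lemma gedge_add_edges (G : kgraph k) (lb : nat -> Lam) i j x y : labelling G lb ->
  gedge (add_edges G i j) x y =
    gedge G x y || [&& (x < nv G)%N, (y < nv G)%N, x != y & lrel i j (lb x) (lb y)].
Proof.
move=> hlb; rewrite /gedge /=; case xn: (x < nv G)%N => //=; case yn: (y < nv G)%N => //=.
rewrite -(lrel_between _ _ hlb xn yn) [between G i j y x]between_sym [y == x]eq_sym.
by case: (x != y) => //=; case: (adj G x y); case: (adj G y x); case: between.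
Qed.

Lemma cq_run (G : kgraph k) (lb : nat -> Lam) (x : assignment l m (nv G)) i :
  labelling G lb -> cq (st (deco lb x)).2 i = minn (cls G i) b.+1.
Proof. by move=> hlb; apply: cqE hlb _ _. Qed.

Lemma count_classes (G : kgraph k) i j :
  count (fun x => (lab G x == i) || (lab G x == j)) (iota 0 (nv G)) =
    if i == j then cls G i else (cls G i + cls G j)%N.
Proof.
rewrite /cls; case: eqP => [->|/eqP nij]; first by apply: eq_count => x; rewrite orbb.
rewrite -count_predUI -[LHS]addn0; congr (_ + _)%N.
rewrite (eq_count (a2 := pred0)) ?count_pred0 // => x /=.
by have [->|//] := eqVneq (lab G x) i; rewrite (negbTE nij).
Qed.

Lemma basic_transfer (o : basic_op k) (G : kgraph k) lb : fits o -> labelling G lb ->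
  exists2 lb', labelling (apply_basic o G) lb' &
    forall q', wsum (apply_basic o G) lb' q' = \sum_q wsum G lb q * basic_matrix o q q'.
Proof.
case: o => [i|i j|i j|b' i j|i j] /= fo hlb.
- exists (fun x => if x == nv G then add_label b i (minn (cls G i) b.+1)
    else add_relabel i (minn (cls G i) b.+1) (lb x)); first exact: (labelling_add i hlb).
  case: G hlb => n adj lab hlb.
  apply: wsum_add => [x wx|x y]; first by rewrite !cq_run.
  rewrite /gedge /=; case xn: (x < n)%N; case yn: (y < n)%N; rewrite ?andbF ?andbT ?orbF //=.
  by rewrite !ltnS (ltnW xn) (ltnW yn).
- exists (fun x => ren_relabel i j (minn (cls G i) b.+1) (minn (cls G j) b.+1) (lb x)).
    exact: labelling_ren.
  case: G hlb => n adj lab hlb.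
  by apply: wsum_ren => x wx a; rewrite !cq_run.
- exists lb => //; have gE := gedge_add_edges i j _ _ hlb.
  case: G hlb gE => n adj lab hlb gE.
  apply: (@wsum_eta K Lam mode k l m A xU xB _ n adj _ lab lab lb (lrel i j)) => //; first exact: lrel_sym.
  by case/andP: fo => /eqP -> /negbTE ->.
- exists lb; first by case: ifP.
  have gE := gedge_add_edges i j _ _ hlb; have cE := count_classes G i j.
  case: G hlb gE cE => n adj lab hlb gE /= ->; set c := (_ <= b')%N.
  have actE (x : assignment l m n) : active b' i j (cq (st (@deco _ _ _ _ (KGraph n adj lab) lb x)).2) = c.
    by rewrite /active !cq_run // /c; case: eqP => _; lia.
  have transfer adj' : (forall x y, gedge (KGraph n adj' lab) x y = gedge (KGraph n adj lab) x y ||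
      [&& (x < n)%N, (y < n)%N, x != y & c && lrel i j (lb x) (lb y)]) ->
    forall q', wsum (KGraph n adj' lab) lb q' =
      \sum_q wsum (KGraph n adj lab) lb q * basic_matrix (OEtaB b' i j) q q'.
    move=> gE'; apply: (@wsum_eta K Lam mode k l m A xU xB _ n adj adj' lab lab lb (fun a a' => c && lrel i j a a')) => //.
    + by move=> a a'; rewrite lrel_sym.
    + by move=> x wx a a' /=; rewrite actE.
    (* If the join acts, both classes have at most [b' <= b] vertices, so the labelling is injective
       on them and the join is thin. *)
    move=> _ x y t xn yn /andP [hc Rxt]; have [lb1 _ _ lb4] := hlb; apply: lb4 => //=.
    have := lb1 x xn; rewrite /= => <-; move: hc Rxt; rewrite /c /lrel.
    case: (eqVneq i j) => [<-|_] hc; first by rewrite orbb => /andP [/eqP -> _]; apply: leq_trans fo.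
    by case/orP => /andP [/eqP -> _]; lia.
  (* When the join does not act, its relation is empty and the letter changes nothing. *)
  case ec: c; apply: transfer => x y; rewrite ec /=; first exact: gE.
  by rewrite !andbF orbF.
- exists lb => //; have bE := fun x y => @lrel_between G lb i j x y hlb.
  case: G hlb bE => n adj lab hlb bE.
  apply: (@wsum_del K Lam mode k l m A xU xB _ n adj _ lab lab lb (lrel i j)) => //; first exact: lrel_sym.
  move=> x y; rewrite /gedge /=; case xn: (x < n)%N => //=; case yn: (y < n)%N => //=.
  rewrite [between _ _ _ y x]between_sym bE //; case: lrel; first by rewrite !andbF.
  by rewrite !andbT.
Qed.

(** The new labelling may depend on the graph and on the old labelling, but one matrix serves them
    all. *)
Definition simulated (F : kgraph k -> kgraph k) (M : 'M[K]_#|{: Q}|) :=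
  forall G lb, labelling G lb -> exists2 lb', labelling (F G) lb' &
    \row_i wsum (F G) lb' (enum_val i) = (\row_i wsum G lb (enum_val i)) *m M.

Lemma simulated_basic o : fits o -> exists M, simulated (apply_basic o) M.
Proof.
move=> fo; exists (\matrix_(i, j) basic_matrix o (enum_val i) (enum_val j)) => G lb hlb.
have [lb' hlb' e] := basic_transfer fo hlb; exists lb' => //.
apply/rowP => j; rewrite !mxE e (reindex _ (onW_bij _ (@enum_val_bij {: Q}))) /=.
by apply: eq_bigr => i _; rewrite !mxE.
Qed.

Lemma simulated_comp F F' M M' : simulated F M -> simulated F' M' ->
  simulated (fun G => F' (F G)) (M *m M').
Proof.
move=> sF sF' G lb /sF [lb1 /sF' [lb2 h2 e2] e1]; exists lb2 => //.
by rewrite e2 e1 mulmxA.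
Qed.

Lemma simulated_id : simulated id 1%:M.
Proof. by move=> G lb hlb; exists lb => //; rewrite mulmx1. Qed.

Lemma simulated_elem (F : elem_op k) : all fits F -> exists M, simulated (apply_elem F) M.
Proof.
rewrite /apply_elem; elim: F => [|o F IH] /=; first by exists 1%:M; apply: simulated_id.
case/andP => /simulated_basic [M sM] /IH [M' sM']; exists (M *m M').
exact: simulated_comp sM sM'.
Qed.

Lemma simulated_iter F M n : simulated F M -> simulated (iter n F) (iter n (mulmx M) 1%:M).
Proof.
move=> sF; elim: n => [|n IH]; first exact: simulated_id.
move=> G lb hlb; have [lb' h e] := simulated_comp sF IH hlb.
by exists lb'; rewrite iterSr.
Qed.

Theorem C2_finite_accepted (acc : pred (state A)) (G0 : kgraph k) (H F L : elem_op k) :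
    all fits H -> all fits F -> all fits L ->
  exists2 a, C2_finite a & forall n, exists lb,
    a n = \sum_(x : assignment l m (nv (bi_iter G0 H F L n)) | within x && acc (run A (deco lb x)))
            weight xU xB x.
Proof.
move=> /simulated_elem [MH sH] /simulated_elem [MF sF] /simulated_elem [ML sL].
have [lb0 hlb0] := @labelling_exists k b G0.
(* Row vectors meet the matrices in the order of application: [ML] first, then the power of [MF],
   then [MH]. *)
pose v := fix v n : 'rV[K]_#|{: Q}| := if n is n'.+1 then
  v n' *m (ML *m iter n' (mulmx MF) 1%:M *m MH) else \row_i wsum G0 lb0 (enum_val i).
pose y : 'cV[K]_#|{: Q}| := \col_i (acc (enum_val i).1)%:R.
exists (fun n => (v n *m y) 0 0); first exact: C2_finite_matrix.
have vP n : exists2 lb, labelling (bi_iter G0 H F L n) lb &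
    v n = \row_i wsum (bi_iter G0 H F L n) lb (enum_val i).
  elim: n => [|n [lb hlb e]]; first by exists lb0.
  have [lb' hlb' e'] := simulated_comp sL (simulated_comp (simulated_iter n sF) sH) hlb.
  by exists lb' => //=; rewrite [RHS]e' e !mulmxA.
move=> n; have [lb _ ->] := vP n; exists lb.
rewrite mxE (reindex _ (onW_bij _ (@enum_rank_bij {: Q}))) /=.
under eq_bigr => q _ do rewrite !mxE enum_rankK /wsum mulr_suml.
rewrite exchange_big /= [RHS]big_mkcondr /=; apply: eq_bigr => x wx.
rewrite (bigD1 (st (deco lb x))) //= eqxx mul1r big1 ?addr0; last first.
  by move=> q /negbTE nq; rewrite eq_sym nq !mul0r.
by case: (acc _); rewrite ?mulr1 ?mulr0.
Qed.

End Operations.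

Lemma C2_finite_ext (K : fieldType) (a a' : nat -> K) : a =1 a' -> C2_finite a -> C2_finite a'.
Proof.
move=> e [s [c [fc [nz rec]]]]; exists s, c; do 2!split=> //; move=> n sn.
by rewrite -e rec //; apply: eq_bigr => i _; rewrite e.
Qed.

Definition threshold k (o : basic_op k) : nat := if o is OEtaB b _ _ then b else 0.

Lemma threshold_max k (s : seq (basic_op k)) :
  all (fun o => threshold o <= \max_(o' <- s) threshold o') s.
Proof.
elim: s => //= o s IH; rewrite big_cons leq_maxl /=.
by apply: sub_all IH => o' h; rewrite leq_max h orbT.
Qed.

Theorem theorem2 (F : numClosedFieldType)
    (l m l' m' : nat) (Phi : msol) (hl : (l' <= l)%N) (hm : (m' <= m)%N)
    (k : nat) (G0 : kgraph k) (H Fop L : elem_op k) :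
  ((m = 0%N /\ no_edgeset Phi) \/
   (bounded_op H /\ bounded_op Fop /\ bounded_op L)) ->
  C2_finite (fun n => msol_poly_val F l m l' m' Phi (bi_iter G0 H Fop L n)).
Proof.
move=> cases.
(* One [b] for all three operations, at least as large as every threshold occurring in them. *)
pose s := H ++ Fop ++ L; pose b := (\max_(o <- s) threshold o)%N.
(* [mode] is false for an MSOL$_G$-polynomial, where arbitrary joins are allowed, and true for a
   bounded family, where edge-set quantifiers are. *)
have [mode [md fitsP]] : exists mode, mode || no_edgeset Phi /\ all (fits b m mode) s.
  case: cases => [[m0 noB]|[bH [bF bL]]].
    exists false; split=> //; apply: sub_all (threshold_max s) => -[] //= *.
    by rewrite m0.
  exists true; split=> //; have := threshold_max s.
  have : all (fun o => ~~ is_eta o) s by rewrite all_predC !has_cat !negb_or; apply/and3P.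
  rewrite -/b; elim: s b => //= o t IH c /andP [no nt] /andP [ob tb].
  by rewrite IH // andbT; case: o no ob.
move: fitsP; rewrite !all_cat => /and3P [fH fF fL].
have [P [A [acc PA]] satP] := @sat_regular ('I_k * 'I_b.+1)%type mode Phi md.
pose K := ratfun F (l' + m')%N.
(* Set variables beyond [l'] or [m'] are summed over without an indeterminate, hence with weight
   1. *)
pose xU (i : 'I_l) : K := if (i < l')%N then Xvar F (l' + m')%N i else 1%R.
pose xB (j : 'I_m) : K := if (j < m')%N then Xvar F (l' + m')%N (l' + j)%N else 1%R.
have [a fa ae] := C2_finite_accepted xU xB acc G0 fH fF fL.
apply: C2_finite_ext fa => n; have [lb ->] := ae n.
rewrite /msol_poly_val pair_big_dep /=; apply: eq_big => [x|x _].
  by rewrite -PA /within; congr (_ && _); apply/esym/satP.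
rewrite /weight; congr (_ * _)%R; rewrite [RHS]big_mkcond /=; apply: eq_bigr => i _.
  by rewrite /xU; case: ifP => //; rewrite expr1n.
by rewrite /xB; case: ifP => //; rewrite expr1n.
Qed.
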